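(* Let $E\to M$ be a complex Hermitian vector bundle with $k$-dimensional fibers, $k\ge1$, over a smooth manifold $M$. Then $\Gamma_0^\infty(E)$ is a $(\Gamma_0^\infty(\mathrm{End}(E))$-$C_0^\infty(M))$-equivalence bimodule.
   Context: $M$ is a finite-dimensional smooth manifold (not assumed compact), $E\to M$ a smooth complex vector bundle with Hermitian fiber metric $h$ (linear in the second argument). The subscript $0$ denotes compact support: $\Gamma_0^\infty(E)$, $\Gamma_0^\infty(\mathrm{End}(E))$ are compactly supported smooth sections and $C_0^\infty(M)$ the compactly supported complex-valued smooth functions. $C_0^\infty(M)$ is a $^*$-algebra under complex conjugation, and $\Gamma_0^\infty(\mathrm{End}(E))$ is a $^*$-algebra under the fiberwise adjoint with respect to $h$. $\Gamma_0^\infty(E)$ is a $(\Gamma_0^\infty(\mathrm{End}(E))$-$C_0^\infty(M))$-bimodule in the obvious way, with the $C_0^\infty(M)$-valued inner product $(u,v)\mapsto h(u,v)$ and the $\Gamma_0^\infty(\mathrm{End}(E))$-valued inner product $(u,v)\mapsto\Theta_{u,v}$, where $\Theta_{u,v}(w)=u\cdot h(v,w)$. Equivalence bimodules (for complex, not necessarily unital, $^*$-algebras). A complex pre-Hilbert space $\mathfrak H$ is a complex vector space with positive-definite Hermitian product, linear in the second argument; $\mathfrak B(\mathfrak H)$ is the $^*$-algebra of all linear maps $\mathfrak H\to\mathfrak H$ having an adjoint on $\mathfrak H$. A $^*$-representation of $\mathcal A$ is a $^*$-homomorphism $\pi:\mathcal A\to\mathfrak B(\mathfrak H)$. A linear functional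 $\omega$ on $\mathcal A$ is positive if $\omega(A^*A)\ge0$ for all $A$; $\mathcal A^+$ is the set of Hermitian $A$ with $\omega(A)\ge0$ for all positive $\omega$. An $\mathcal A$-valued inner product on a right $\mathcal A$-module $\mathfrak X$ (with compatible $\mathbb C$-vector space structure) is a map $\langle\cdot,\cdot\rangle_{\mathcal A}$, $\mathbb C$- and right $\mathcal A$-linear in the second argument, with $\langle x,y\rangle_{\mathcal A}=\langle y,x\rangle_{\mathcal A}^*$. It is positive semi-definite if $\langle x,x\rangle_{\mathcal A}\in\mathcal A^+$, and full if the span of all $\langle x,y\rangle_{\mathcal A}$ is $\mathcal A$. For a left $\mathcal B$-module, ${}_{\mathcal B}\langle\cdot,\cdot\rangle$ is analogous with linearity in the first argument. A $(\mathcal B$-$\mathcal A)$-equivalence bimodule is a $(\mathcal B$-$\mathcal A)$-bimodule $\mathfrak X$ with full positive semi-definite inner products $\langle\cdot,\cdot\rangle_{\mathcal A}$ and ${}_{\mathcal B}\langle\cdot,\cdot\rangle$ such that: $\langle B\cdot x,y\rangle_{\mathcal A}=\langle x,B^*\cdot y\rangle_{\mathcal A}$ and ${}_{\mathcal B}\langle x\cdot A,y\rangle={}_{\mathcal B}\langle x,y\cdot A^*\rangle$; $x\cdot\langle y,z\rangle_{\mathcal A}={}_{\mathcal B}\langle x,y\rangle\cdot z$; property P: for every $^*$-representation $(\pi,\mathfrak H)$ of $\mathcal A$ the Hermitian product on $\mathfrak X\otimes_{\mathcal A}\mathfrak H$ determined by $\langle x\otimes\psi,y\otimes\phi\rangle=\langle\psi,\pi(\langle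 x,y\rangle_{\mathcal A})\phi\rangle_{\mathfrak H}$ is positive semi-definite; property Q: the conjugate $(\mathcal A$-$\mathcal B)$-bimodule $\overline{\mathfrak X}$ (same additive group, elements $\overline x$, with $z\overline x=\overline{\overline zx}$, $A\cdot\overline x=\overline{x\cdot A^*}$, $\overline x\cdot B=\overline{B^*\cdot x}$, $\langle\overline x,\overline y\rangle_{\mathcal B}={}_{\mathcal B}\langle x,y\rangle$) has property P with respect to $\mathcal B$. *)

(* Defs.v *)
From HB Require Import structures.
From mathcomp Require Import all_boot all_order all_algebra generic_quotient.
From mathcomp Require Import complex.
From mathcomp Require Import boolp classical_sets functions reals topology.
From mathcomp Require Import normedtype derive.

Set Implicit Arguments.
Unset Strict Implicit.
Unset Printing Implicit Defensive.

Import Order.TTheory GRing.Theory Num.Theory.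
Import numFieldNormedType.Exports.

Local Open Scope classical_set_scope.
Local Open Scope ring_scope.

(* A linear subspace P of a dependent product [forall i, V i], as a type.     *)
Section PiSub.
Variables (K : pzRingType) (I : Type) (V : I -> lmodType K).

Definition pi_submod_closed (P : set (forall i, V i)) : Prop :=
  [/\ P (fun=> 0),
      forall f g, P f -> P g -> P (fun i => f i + g i)
    & forall a f, P f -> P (fun i => a *: f i)].

Record piSub (P : set (forall i, V i)) (cP : pi_submod_closed P) := PiSub {
  pi_fun :> forall i, V i;
  pi_funP : P pi_fun }.

Variables (P : set (forall i, V i)) (cP : pi_submod_closed P).
Local Notation T := (piSub cP).

Lemma piSub_ext (f g : T) : (forall i, f i = g i) -> f = g.
Proof.
case: f g => [f Pf] [g Pg] /= fg.
have E : f = g by apply: functional_extensionality_dep.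
by case: _ / E in Pg *; congr PiSub; apply: Prop_irrelevance.
Qed.

HB.instance Definition _ := gen_eqMixin T.
HB.instance Definition _ := gen_choiceMixin T.

Definition piSub0 : T := PiSub cP (let: And3 h _ _ := cP in h).
Definition piSubD (f g : T) : T :=
  PiSub cP (let: And3 _ h _ := cP in h _ _ (pi_funP f) (pi_funP g)).
Definition piSubZ (a : K) (f : T) : T :=
  PiSub cP (let: And3 _ _ h := cP in h a _ (pi_funP f)).
Definition piSubN (f : T) : T := piSubZ (- 1) f.

Let piSubA : associative piSubD.
Proof. by move=> f g h; apply: piSub_ext => i; apply: addrA. Qed.
Let piSubC : commutative piSubD.
Proof. by move=> f g; apply: piSub_ext => i; apply: addrC. Qed.
Let piSub0D : left_id piSub0 piSubD.
Proof. by move=> f; apply: piSub_ext => i; apply: add0r. Qed.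
Let piSubND : left_inverse piSub0 piSubN piSubD.
Proof. by move=> f; apply: piSub_ext => i /=; rewrite scaleN1r addNr. Qed.

HB.instance Definition _ :=
  GRing.isZmodule.Build T piSubA piSubC piSub0D piSubND.

Let piSubZA a b f : piSubZ a (piSubZ b f) = piSubZ (a * b) f.
Proof. by apply: piSub_ext => i; apply: scalerA. Qed.
Let piSubZ1 : left_id 1 piSubZ.
Proof. by move=> f; apply: piSub_ext => i; apply: scale1r. Qed.
Let piSubZDr : right_distributive piSubZ +%R.
Proof. by move=> a f g; apply: piSub_ext => i; apply: scalerDr. Qed.
Let piSubZDl f : {morph piSubZ^~ f : a b / a + b}.
Proof. by move=> a b; apply: piSub_ext => i; apply: scalerDl. Qed.

HB.instance Definition _ :=
  GRing.Zmodule_isLmodule.Build K T piSubZA piSubZ1 piSubZDr piSubZDl.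

Lemma piSubDE (f g : T) i : (f + g) i = f i + g i. Proof. by []. Qed.
Lemma piSubZE a (f : T) i : (a *: f) i = a *: f i. Proof. by []. Qed.
Lemma piSub0E i : (0 : T) i = 0. Proof. by []. Qed.

End PiSub.

Section StarAlgebra.
Variable C : numClosedFieldType.

(* Not necessarily commutative, not necessarily unital.                       *)
Record starAlgebra := StarAlgebra {
  sa_sort :> lmodType C;
  smul : sa_sort -> sa_sort -> sa_sort;
  star : sa_sort -> sa_sort;
  smulA : associative smul;
  smulDl : left_distributive smul +%R;
  smulDr : right_distributive smul +%R;
  smulZl : forall z a b, smul (z *: a) b = z *: smul a b;
  smulZr : forall z a b, smul a (z *: b) = z *: smul a b;
  starK : involutive star;
  starD : {morph star : a b / a + b};
  starZ : forall z a, star (z *: a) = z^* *: star a;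
  starM : forall a b, star (smul a b) = smul (star b) (star a) }.

Definition positive_functional (A : starAlgebra) (omega : {scalar A}) : Prop :=
  forall a, 0 <= omega (smul (star a) a).

Definition positive_cone (A : starAlgebra) : set A :=
  [set a | star a = a /\
     forall omega : {scalar A}, positive_functional omega -> 0 <= omega a].

Record preHilbert := PreHilbert {
  ph_sort :> lmodType C;
  ip : ph_sort -> ph_sort -> C;
  ip_linear : forall x, scalar (ip x);
  ip_herm : forall x y, ip x y = (ip y x)^*;
  ip_pos : forall x, x <> 0 -> 0 < ip x x }.

Section InnerProduct.
Variable H : preHilbert.
Implicit Types x y z : H.

Lemma ipDr x y z : ip x (y + z) = ip x y + ip x z.
Proof. by have := ip_linear x 1 y z; rewrite scale1r mul1r. Qed.

Lemma ip0r x : ip x 0 = 0.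
Proof. by apply: (addrI (ip x 0)); rewrite -ipDr !addr0. Qed.

Lemma ipZr a x y : ip x (a *: y) = a * ip x y.
Proof. by have := ip_linear x a y 0; rewrite ip0r !addr0. Qed.

Lemma ipDl x y z : ip (x + y) z = ip x z + ip y z.
Proof. by rewrite ip_herm ipDr rmorphD /= -!ip_herm. Qed.

Lemma ipZl a x y : ip (a *: x) y = a^* * ip x y.
Proof. by rewrite ip_herm ipZr rmorphM /= -ip_herm. Qed.

Lemma ip_inj x y : (forall z, ip z x = ip z y) -> x = y.
Proof.
move=> E; apply/eqP; rewrite -subr_eq0; apply/eqP; apply: contrapT => ne.
have := ip_pos ne; rewrite -[X in ip _ (_ + X)]scaleN1r ipDr ipZr E mulN1r subrr.
by rewrite ltxx.
Qed.

End InnerProduct.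

Section Adjointable.
Variable H : preHilbert.

Definition is_adjoint (f g : H -> H) : Prop :=
  forall x y, ip (g x) y = ip x (f y).

Definition adjointable : set (H -> H) :=
  [set f | linear f /\ exists2 g, linear g & is_adjoint f g].

Lemma adjointable_closed :
  pi_submod_closed (V := fun=> (H : lmodType C)) adjointable.
Proof.
split.
- split=> [a x y /=|]; first by rewrite scaler0 addr0.
  exists (fun=> 0) => [a x y /=|x y]; first by rewrite scaler0 addr0.
  by rewrite ip_herm !ip0r conjC0.
- move=> f g [lf [f' lf' af]] [lg [g' lg' ag]]; split=> [a x y|].
    by rewrite lf lg scalerDr addrACA.
  exists (fun x => f' x + g' x) => [a x y|x y].
    by rewrite lf' lg' scalerDr addrACA.
  by rewrite ipDl ipDr af ag.
- move=> a f [lf [f' lf' af]]; split=> [b x y|].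
    by rewrite lf scalerDr !scalerA mulrC.
  exists (fun x => a^* *: f' x) => [b x y|x y].
    by rewrite lf' scalerDr !scalerA mulrC.
  by rewrite ipZl ipZr af conjCK.
Qed.

Definition adjOp := piSub adjointable_closed.

Lemma adjOp_adj (f : adjOp) : exists g, linear g /\ is_adjoint f g.
Proof. by have [_ [g lg ag]] := pi_funP f; exists g. Qed.

Definition adj_fun (f : adjOp) : H -> H := projT1 (cid (adjOp_adj f)).

Lemma adj_funP (f : adjOp) x y : ip (adj_fun f x) y = ip x (f y).
Proof. exact: (projT2 (cid (adjOp_adj f))).2. Qed.

Lemma adj_fun_adjointable (f : adjOp) : adjointable (adj_fun f).
Proof.
have [lf _] := pi_funP f.
split; first exact: (projT2 (cid (adjOp_adj f))).1.
by exists f => // x y; rewrite [RHS]ip_herm adj_funP -ip_herm.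
Qed.

Definition adjOp_star (f : adjOp) : adjOp :=
  PiSub adjointable_closed (adj_fun_adjointable f).

Lemma comp_adjointable (f g : adjOp) : adjointable (f \o g).
Proof.
have [[lf [f' lf' af]] [lg [g' lg' ag]]] := (pi_funP f, pi_funP g).
split=> [a x y /=|]; first by rewrite lg lf.
by exists (g' \o f') => [a x y /=|x y /=]; rewrite ?lf' ?lg' // ag af.
Qed.

Definition adjOp_mul (f g : adjOp) : adjOp :=
  PiSub adjointable_closed (comp_adjointable f g).

Lemma adjOp_ext (f g : adjOp) :
  (forall x y, ip x (f y) = ip x (g y)) -> f = g.
Proof. by move=> E; apply: piSub_ext => y; apply: ip_inj => x; apply: E. Qed.

Lemma ip_starE (f : adjOp) x y : ip x (adjOp_star f y) = ip (f x) y.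
Proof.
by rewrite ip_herm -[adjOp_star f y]/(adj_fun f y) adj_funP -ip_herm.
Qed.

Fact adjOp_mulA : associative adjOp_mul.
Proof. by move=> f g k; apply: piSub_ext. Qed.
Fact adjOp_mulDl : left_distributive adjOp_mul +%R.
Proof. by move=> f g k; apply: piSub_ext. Qed.
Fact adjOp_mulDr : right_distributive adjOp_mul +%R.
Proof.
move=> f g k; apply: piSub_ext => x; have [lf _] := pi_funP f.
by rewrite piSubDE /= -[g x]scale1r lf !scale1r.
Qed.
Fact adjOp_mulZl z f g : adjOp_mul (z *: f) g = z *: adjOp_mul f g.
Proof. exact: piSub_ext. Qed.
Fact adjOp_mulZr z f g : adjOp_mul f (z *: g) = z *: adjOp_mul f g.
Proof.
apply: adjOp_ext => x y; have [lf _] := pi_funP f.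
have [f' lf' af] := (pi_funP f).2.
by rewrite piSubZE /= ipZr -!af ipZr.
Qed.
Fact adjOp_starK : involutive adjOp_star.
Proof.
move=> f; apply: adjOp_ext => x y.
by rewrite ip_starE -[adjOp_star f x]/(adj_fun f x) adj_funP.
Qed.
Fact adjOp_starD : {morph adjOp_star : f g / f + g}.
Proof.
move=> f g; apply: adjOp_ext => x y.
by rewrite ip_starE !piSubDE ipDl ipDr !ip_starE.
Qed.
Fact adjOp_starZ z f : adjOp_star (z *: f) = z^* *: adjOp_star f.
Proof.
apply: adjOp_ext => x y.
by rewrite ip_starE !piSubZE ipZl ipZr ip_starE.
Qed.
Fact adjOp_starM f g :
  adjOp_star (adjOp_mul f g) = adjOp_mul (adjOp_star g) (adjOp_star f).
Proof. by apply: adjOp_ext => x y; rewrite ip_starE /= !ip_starE. Qed.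

(* The *-algebra usually written B(H); its elements need not be bounded when  *)
(* H is not complete.                                                         *)
Definition adjointableOps : starAlgebra :=
  StarAlgebra adjOp_mulA adjOp_mulDl adjOp_mulDr adjOp_mulZl adjOp_mulZr
    adjOp_starK adjOp_starD adjOp_starZ adjOp_starM.

End Adjointable.

Record starRep (A : starAlgebra) (H : preHilbert) := StarRep {
  rep :> A -> adjointableOps H;
  rep_linear : linear rep;
  repM : forall a b, rep (smul a b) = smul (rep a) (rep b);
  rep_star : forall a, rep (star a) = star (rep a) }.

Record bimodule (B A : starAlgebra) := Bimodule {
  bm_sort :> lmodType C;
  lact : B -> bm_sort -> bm_sort;
  ract : bm_sort -> A -> bm_sort;
  lact_linearl : forall x, linear (lact^~ x);
  lact_linearr : forall b, linear (lact b);
  ract_linearl : forall a, linear (ract^~ a);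
  ract_linearr : forall x, linear (ract x);
  lactM : forall b c x, lact (smul b c) x = lact b (lact c x);
  ractM : forall x a c, ract x (smul a c) = ract (ract x a) c;
  lract : forall b x a, lact b (ract x a) = ract (lact b x) a }.

Section InnerProducts.
Variables (B A : starAlgebra) (X : bimodule B A).

Definition right_inner_product (ipA : X -> X -> A) : Prop :=
  [/\ forall x, linear (ipA x),
      forall x y a, ipA x (ract y a) = smul (ipA x y) a
    & forall x y, ipA x y = star (ipA y x)].

Definition left_inner_product (ipB : X -> X -> B) : Prop :=
  [/\ forall y, linear (ipB^~ y),
      forall b x y, ipB (lact b x) y = smul b (ipB x y)
    & forall x y, ipB x y = star (ipB y x)].

Definition positive_semidefinite (D : starAlgebra) (ipD : X -> X -> D) : Prop :=
  forall x, positive_cone (ipD x x).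

Definition full (D : starAlgebra) (ipD : X -> X -> D) : Prop :=
  forall d, exists s : seq (C * (X * X)),
    d = \sum_(p <- s) p.1 *: ipD p.2.1 p.2.2.

End InnerProducts.

(* X (x)_A H: finite sums of elementary tensors, two of them being equal when *)
(* no C-bilinear A-balanced map into a complex vector space separates them.   *)
Section Tensor.
Variables (B A : starAlgebra) (X : bimodule B A).
Variables (H : preHilbert) (pi : starRep A H).

Record balanced (V : lmodType C) (beta : X -> H -> V) : Prop := Balanced {
  bal_linearl : forall psi, linear (beta^~ psi);
  bal_linearr : forall x, linear (beta x);
  bal_act : forall x a psi, beta (ract x a) psi = beta x (pi a psi) }.

Definition tsum (V : lmodType C) (beta : X -> H -> V) (s : seq (X * H)) : V :=
  \sum_(p <- s) beta p.1 p.2.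

Definition tensor_rel (s t : seq (X * H)) : bool :=
  `[< forall (V : lmodType C) (beta : X -> H -> V),
        balanced beta -> tsum beta s = tsum beta t >].

Fact tensor_rel_refl : reflexive tensor_rel.
Proof. by move=> s; apply/asboolP. Qed.
Fact tensor_rel_sym : symmetric tensor_rel.
Proof. by move=> s t; apply/asboolP/asboolP => E V b /E. Qed.
Fact tensor_rel_trans : transitive tensor_rel.
Proof.
move=> t s u /asboolP st /asboolP tu; apply/asboolP => V b bb.
by rewrite (st _ _ bb) (tu _ _ bb).
Qed.

Canonical tensor_equiv :=
  EquivRel tensor_rel tensor_rel_refl tensor_rel_sym tensor_rel_trans.

Definition tensor := {eq_quot tensor_rel}%qT.
HB.instance Definition _ := Choice.on tensor.
HB.instance Definition _ := EqQuotient.on tensor.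

Definition tensor_of (s : seq (X * H)) : tensor := (\pi_tensor s)%qT.
Definition tens (x : X) (psi : H) : tensor := tensor_of [:: (x, psi)].
Definition tlift (V : lmodType C) (beta : X -> H -> V) (z : tensor) : V := tsum beta (repr z).

Lemma tlift_of (V : lmodType C) (beta : X -> H -> V) s :
  balanced beta -> tlift beta (tensor_of s) = tsum beta s.
Proof.
move=> bb; rewrite /tlift.
have /eqmodP/asboolP : (repr (tensor_of s) = s %[mod tensor])%qT by rewrite reprK.
by apply.
Qed.

Lemma tensor_ext (z w : tensor) :
  (forall (V : lmodType C) (beta : X -> H -> V),
     balanced beta -> tlift beta z = tlift beta w) -> z = w.
Proof.
move=> E; rewrite -[z]reprK -[w]reprK.
by apply/eqmodP/asboolP => V b /E.
Qed.

Definition tensor0 : tensor := tensor_of [::].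
Definition tensorD (z w : tensor) : tensor := tensor_of (repr z ++ repr w).
Definition tensorZ (a : C) (z : tensor) : tensor :=
  tensor_of [seq (a *: p.1, p.2) | p <- repr z].
Definition tensorN (z : tensor) : tensor := tensorZ (- 1) z.

Section Lift.
Variables (V : lmodType C) (beta : X -> H -> V) (bb : balanced beta).

Lemma tlift0 : tlift beta tensor0 = 0.
Proof. by rewrite tlift_of // /tsum big_nil. Qed.
Lemma tliftD z w : tlift beta (tensorD z w) = tlift beta z + tlift beta w.
Proof. by rewrite tlift_of // /tsum big_cat. Qed.
Lemma bal0l psi : beta 0 psi = 0.
Proof.
have := bal_linearl bb psi 1 0 0; rewrite !scale1r addr0 => E.
by apply: (addrI (beta 0 psi)); rewrite addr0 -E.
Qed.
Lemma balZl a x psi : beta (a *: x) psi = a *: beta x psi.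
Proof. by have := bal_linearl bb psi a x 0; rewrite bal0l !addr0. Qed.
Lemma tliftZ a z : tlift beta (tensorZ a z) = a *: tlift beta z.
Proof.
rewrite tlift_of // /tsum big_map scaler_sumr.
by apply: eq_bigr => p _; rewrite balZl.
Qed.
Lemma tlift_tens x psi : tlift beta (tens x psi) = beta x psi.
Proof. by rewrite tlift_of // /tsum big_seq1. Qed.

End Lift.

Let tensorA : associative tensorD.
Proof. by move=> x y z; apply: tensor_ext => V b bb; rewrite !tliftD // addrA. Qed.
Let tensorC : commutative tensorD.
Proof. by move=> x y; apply: tensor_ext => V b bb; rewrite !tliftD // addrC. Qed.
Let tensor0D : left_id tensor0 tensorD.
Proof. by move=> x; apply: tensor_ext => V b bb; rewrite tliftD // tlift0 // add0r. Qed.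
Let tensorND : left_inverse tensor0 tensorN tensorD.
Proof.
move=> x; apply: tensor_ext => V b bb.
by rewrite tliftD // tliftZ // tlift0 // scaleN1r addNr.
Qed.

HB.instance Definition _ :=
  GRing.isZmodule.Build tensor tensorA tensorC tensor0D tensorND.

Let tensorZA a b x : tensorZ a (tensorZ b x) = tensorZ (a * b) x.
Proof. by apply: tensor_ext => V f fb; rewrite !tliftZ // scalerA. Qed.
Let tensorZ1 : left_id 1 tensorZ.
Proof. by move=> x; apply: tensor_ext => V f fb; rewrite !tliftZ // scale1r. Qed.
Let tensorZDr : right_distributive tensorZ +%R.
Proof.
move=> a x y; apply: tensor_ext => V f fb.
by rewrite tliftZ // !tliftD // !tliftZ // scalerDr.
Qed.
Let tensorZDl x : {morph tensorZ^~ x : a b / a + b}.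
Proof.
move=> a b; apply: tensor_ext => V f fb.
by rewrite tliftZ // !tliftD // !tliftZ // scalerDl.
Qed.

HB.instance Definition _ :=
  GRing.Zmodule_isLmodule.Build C tensor tensorZA tensorZ1 tensorZDr tensorZDl.

Variable ipA : X -> X -> A.

(* The form determined by (x (x) psi, y (x) phi) |-> <psi, pi(<x, y>) phi>;    *)
(* see tensor_formE.                                                          *)
Definition tensor_form (z w : tensor) : C :=
  \sum_(p <- repr z) \sum_(q <- repr w) ip p.2 (pi (ipA p.1 q.1) q.2).

(* The form does not depend on the representatives chosen by [repr].          *)
Section TensorForm.
Hypothesis ipAP : right_inner_product ipA.

Let form1 (s : seq (X * H)) (y : X) (phi : H) : C^o :=
  \sum_(p <- s) ip p.2 (pi (ipA p.1 y) phi).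

Let form1_balanced s : balanced (form1 s).
Proof.
have [lA aA _] := ipAP.
split=> [phi a x y|y a phi psi|y a phi]; rewrite /form1.
- rewrite scaler_sumr -big_split; apply: eq_bigr => p _ /=.
  by rewrite lA rep_linear ip_linear.
- rewrite scaler_sumr -big_split; apply: eq_bigr => p _ /=.
  by have [lp _] := pi_funP (pi (ipA p.1 y)); rewrite lp ip_linear.
- by apply: eq_bigr => p _; rewrite aA repM.
Qed.

Lemma tensor_form_liftE z w : tensor_form z w = tlift (form1 (repr z)) w.
Proof. exact: exchange_big. Qed.

Lemma tensor_form_herm z w : tensor_form z w = (tensor_form w z)^*.
Proof.
have [_ _ sA] := ipAP.
rewrite /tensor_form exchange_big rmorph_sum; apply: eq_bigr => q _ /=.
rewrite rmorph_sum; apply: eq_bigr => p _ /=.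
by rewrite -ip_herm sA rep_star ip_starE.
Qed.

Lemma tensor_form_linear z : scalar (tensor_form z).
Proof.
move=> a w v; rewrite !tensor_form_liftE.
have E : a *: w + v = tensorD (tensorZ a w) v by [].
by rewrite E tliftD // tliftZ.
Qed.

Lemma tensor_formE x psi y phi :
  tensor_form (tens x psi) (tens y phi) = ip psi (pi (ipA x y) phi).
Proof.
have [_ _ sA] := ipAP.
have swap a b c d : ip b (pi (ipA a c) d) = (ip d (pi (ipA c a) b))^*.
  by rewrite -ip_herm sA rep_star ip_starE.
rewrite tensor_form_liftE tlift_tens // swap.
have <- : tlift (form1 [:: (y, phi)]) (tens x psi) = ip phi (pi (ipA y x) psi).
  by rewrite tlift_tens // /form1 big_seq1.
rewrite /tlift /tsum rmorph_sum; apply: eq_bigr => p _ /=.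
by rewrite /form1 big_seq1 swap.
Qed.

End TensorForm.
End Tensor.

Definition property_P (B A : starAlgebra) (X : bimodule B A)
    (ipA : X -> X -> A) : Prop :=
  forall (H : preHilbert) (pi : starRep A H) (z : tensor X pi),
    0 <= tensor_form ipA z z.

Definition conj_mod (V : lmodType C) : Type := V.

Section ConjMod.
Variable V : lmodType C.

HB.instance Definition _ := GRing.Zmodule.on (conj_mod V).

Definition conj_scale (z : C) (x : conj_mod V) : conj_mod V :=
  z^* *: (x : V).

Let conj_scaleA a b x : conj_scale a (conj_scale b x) = conj_scale (a * b) x.
Proof. by rewrite /conj_scale scalerA rmorphM. Qed.
Let conj_scale1 : left_id 1 conj_scale.
Proof. by move=> x; rewrite /conj_scale rmorph1 scale1r. Qed.
Let conj_scaleDr : right_distributive conj_scale +%R.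
Proof. by move=> a x y; apply: scalerDr. Qed.
Let conj_scaleDl x : {morph conj_scale^~ x : a b / a + b}.
Proof. by move=> a b; rewrite /conj_scale rmorphD; apply: scalerDl. Qed.

HB.instance Definition _ := GRing.Zmodule_isLmodule.Build C (conj_mod V)
  conj_scaleA conj_scale1 conj_scaleDr conj_scaleDl.

Lemma conj_modZ z (x : conj_mod V) : z *: x = z^* *: (x : V) :> V.
Proof. by []. Qed.

End ConjMod.

Section ConjBimodule.
Variables (B A : starAlgebra) (X : bimodule B A).

Definition conj_lact (a : A) (x : conj_mod X) : conj_mod X :=
  ract (x : X) (star a).
Definition conj_ract (x : conj_mod X) (b : B) : conj_mod X :=
  lact (star b) (x : X).

Fact conj_lact_linearl x : linear (conj_lact^~ x).
Proof.
by move=> z a c; rewrite /conj_lact starD starZ (ract_linearr (x : X)).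
Qed.
Fact conj_lact_linearr a : linear (conj_lact a).
Proof. by move=> z x y; apply: (ract_linearl (star a)). Qed.
Fact conj_ract_linearl b : linear (conj_ract^~ b).
Proof. by move=> z x y; apply: (lact_linearr (star b)). Qed.
Fact conj_ract_linearr x : linear (conj_ract x).
Proof.
by move=> z b c; rewrite /conj_ract starD starZ (lact_linearl (x : X)).
Qed.
Fact conj_lactM a c x : conj_lact (smul a c) x = conj_lact a (conj_lact c x).
Proof. by rewrite /conj_lact starM ractM. Qed.
Fact conj_ractM x b c : conj_ract x (smul b c) = conj_ract (conj_ract x b) c.
Proof. by rewrite /conj_ract starM lactM. Qed.
Fact conj_lract a x b :
  conj_lact a (conj_ract x b) = conj_ract (conj_lact a x) b.
Proof. by rewrite /conj_lact /conj_ract lract. Qed.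

Definition conj_bimodule : bimodule A B :=
  Bimodule conj_lact_linearl conj_lact_linearr conj_ract_linearl
    conj_ract_linearr conj_lactM conj_ractM conj_lract.

Definition property_Q (ipB : X -> X -> B) : Prop :=
  property_P (X := conj_bimodule) ipB.

End ConjBimodule.

Record equivalence_bimodule (B A : starAlgebra) (X : bimodule B A)
    (ipA : X -> X -> A) (ipB : X -> X -> B) : Prop := EquivalenceBimodule {
  eqb_ipA : right_inner_product ipA;
  eqb_ipB : left_inner_product ipB;
  eqb_posA : positive_semidefinite ipA;
  eqb_posB : positive_semidefinite ipB;
  eqb_fullA : full ipA;
  eqb_fullB : full ipB;
  eqb_lact : forall b x y, ipA (lact b x) y = ipA x (lact (star b) y);
  eqb_ract : forall x a y, ipB (ract x a) y = ipB x (ract y (star a));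
  eqb_compat : forall x y z, ract x (ipA y z) = lact (ipB x y) z;
  eqb_P : property_P ipA;
  eqb_Q : property_Q ipB }.

End StarAlgebra.

Section SmoothRn.
Variables (R : realType) (n : nat).
Implicit Types (U V : set 'rV[R]_n) (f g : 'rV[R]_n -> R).

Definition iter_partial (s : seq 'I_n) f : 'rV[R]_n -> R :=
  foldr (fun i g => 'D_'e_i g) f s.

(* C^oo on U: all iterated partial derivatives exist and are continuous on U. *)
Definition smooth_on U f : Prop :=
  forall x, U x -> forall s : seq 'I_n,
    {for x, continuous (iter_partial s f)} /\
    forall i, derivable (iter_partial s f) x 'e_i.

Fixpoint Ck (k : nat) U f : Prop :=
  (forall x, U x -> {for x, continuous f}) /\
  if k is k'.+1 then
    forall i, (forall x, U x -> derivable f x 'e_i) /\ Ck k' U ('D_'e_i f)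
  else True.

Lemma smooth_on_partial U f i : smooth_on U f -> smooth_on U ('D_'e_i f).
Proof.
move=> sf x Ux s; have := sf x Ux (rcons s i).
by rewrite /iter_partial foldr_rcons.
Qed.

Lemma smooth_onP U f : smooth_on U f <-> forall k, Ck k U f.
Proof.
split=> [sf k|Cf x Ux s].
  elim: k f sf => [|k IH] f sf /=; split=> //.
  - by move=> x Ux; have [] := sf x Ux [::].
  - by move=> x Ux; have [] := sf x Ux [::].
  - move=> i; split; last exact/IH/smooth_on_partial.
    by move=> x Ux; have [_] := sf x Ux [::]; apply.
elim/last_ind: s f Cf => [|s i IH] f Cf.
  have [cf df] := Cf 1%N; split; first exact: cf.
  by move=> i; have [+ _] := df i; apply.
rewrite /iter_partial foldr_rcons; apply: IH => k.
by have [_ df] := Cf k.+1; have [_] := df i.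
Qed.

Lemma CkW k U f : Ck k.+1 U f -> Ck k U f.
Proof.
elim: k f => [|k IH] f [cf df]; split=> // i.
by have [d c] := df i; split=> //; apply: IH.
Qed.

Lemma Ck_cont k U f x : Ck k U f -> U x -> {for x, continuous f}.
Proof. by case: k => [|k] [cf _]; apply: cf. Qed.

Lemma Ck_ext k U f g : open U -> (forall x, U x -> f x = g x) ->
  Ck k U f -> Ck k U g.
Proof.
move=> oU.
have nearU (u v : 'rV[R]_n -> R) : (forall x, U x -> u x = v x) ->
    forall x, U x -> \near x, u x = v x.
  move=> uv x Ux; near=> y; apply: uv; near: y.
  exact: open_nbhs_nbhs.
have contU (u v : 'rV[R]_n -> R) : (forall x, U x -> u x = v x) ->
    forall x, U x -> {for x, continuous u} -> {for x, continuous v}.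
  move=> uv x Ux cu; rewrite /prop_for /continuous_at -(uv x Ux).
  by apply: cvg_trans cu; apply: (@near_eq_cvg _ _ (nbhs x)); apply: nearU.
elim: k f g => [|k IH] f g fg [cf df]; split=> //.
- by move=> x Ux; apply: contU (cf x Ux).
- by move=> x Ux; apply: contU (cf x Ux).
- move=> i; have [d c] := df i; split=> [x Ux|].
    by apply: near_eq_derivable (d x Ux); apply: nearU.
  by apply: IH c => x Ux; apply: near_eq_derive; apply: nearU.
Unshelve. all: by end_near. Qed.

Lemma Ck_cst k U (a : R) : Ck k U (fun=> a).
Proof.
elim: k a => [|k IH] a; split=> //; try by move=> x _; exact: cst_continuous.
move=> i; split=> [x _|]; first exact: derivable_cst.
have -> : 'D_'e_i (fun=> a) = (fun=> 0) :> ('rV[R]_n -> R).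
  by apply/funext => x; exact: derive_cst.
exact: IH.
Qed.

Lemma CkD k U f g : open U -> Ck k U f -> Ck k U g ->
  Ck k U (fun x => f x + g x).
Proof.
move=> oU; elim: k f g => [|k IH] f g [cf df] [cg dg]; split=> //.
- by move=> x Ux; apply: continuousD; [exact: cf|exact: cg].
- by move=> x Ux; apply: continuousD; [exact: cf|exact: cg].
- move=> i; have [d1 c1] := df i; have [d2 c2] := dg i; split=> [x Ux|].
    by apply: derivableD; [exact: d1|exact: d2].
  apply: Ck_ext (IH _ _ c1 c2) => // x Ux.
  by rewrite deriveD //; [exact: d1|exact: d2].
Qed.

Lemma CkM k U f g : open U -> Ck k U f -> Ck k U g ->
  Ck k U (fun x => f x * g x).
Proof.
move=> oU; elim: k f g => [|k IH] f g Cf Cg.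
  by split=> // x Ux; apply: continuousM; [exact: Cf.1|exact: Cg.1].
have [cf df] := Cf; have [cg dg] := Cg; split=> [x Ux|i].
  by apply: continuousM; [exact: cf|exact: cg].
have [d1 c1] := df i; have [d2 c2] := dg i; split=> [x Ux|].
  by apply: derivableM; [exact: d1|exact: d2].
have := CkD oU (IH _ _ (CkW Cf) c2) (IH _ _ (CkW Cg) c1).
apply: Ck_ext => // x Ux.
by rewrite deriveM //; [exact: d1|exact: d2].
Qed.

Lemma CkV k U f : open U -> (forall x, U x -> f x != 0) -> Ck k U f ->
  Ck k U (fun x => (f x)^-1).
Proof.
move=> oU f0; elim: k => [|k IH] Cf.
  by split=> // x Ux; apply: continuousV; [exact: f0|exact: Cf.1].
have [cf df] := Cf; split=> [x Ux|i].
  by apply: continuousV; [exact: f0|exact: cf].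
have [d c] := df i; split=> [x Ux|].
  by apply: derivableV; [exact: f0|exact: d].
have CI := IH (CkW Cf).
have := CkM oU (CkM oU (Ck_cst k U (- 1)) (CkM oU CI CI)) c.
apply: Ck_ext => // x Ux.
rewrite deriveV; [|exact: f0|exact: d].
by rewrite -invfM -expr2 mulN1r.
Qed.

Lemma smooth_on_ext U f g : open U -> (forall x, U x -> f x = g x) ->
  smooth_on U f -> smooth_on U g.
Proof.
by move=> oU fg /smooth_onP Cf; apply/smooth_onP => k; apply: Ck_ext (Cf k).
Qed.

Lemma smooth_on_cst U a : smooth_on U (fun=> a).
Proof. by apply/smooth_onP => k; apply: Ck_cst. Qed.

Lemma smooth_onD U f g : open U -> smooth_on U f -> smooth_on U g ->
  smooth_on U (fun x => f x + g x).
Proof.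
move=> oU /smooth_onP Cf /smooth_onP Cg.
by apply/smooth_onP => k; apply: CkD.
Qed.

Lemma smooth_onM U f g : open U -> smooth_on U f -> smooth_on U g ->
  smooth_on U (fun x => f x * g x).
Proof.
move=> oU /smooth_onP Cf /smooth_onP Cg.
by apply/smooth_onP => k; apply: CkM.
Qed.

Lemma smooth_onV U f : open U -> (forall x, U x -> f x != 0) ->
  smooth_on U f -> smooth_on U (fun x => (f x)^-1).
Proof.
move=> oU f0 /smooth_onP Cf.
by apply/smooth_onP => k; apply: CkV.
Qed.

Lemma smooth_onN U f : open U -> smooth_on U f -> smooth_on U (fun x => - f x).
Proof.
move=> oU sf; have := smooth_onM oU (smooth_on_cst (U := U) (- 1)) sf.
by apply: smooth_on_ext => // x _; rewrite mulN1r.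
Qed.

Definition csmooth_on U (f : 'rV[R]_n -> R[i]) : Prop :=
  smooth_on U (fun x => complex.Re (f x)) /\
  smooth_on U (fun x => complex.Im (f x)).

Section ComplexSmooth.
Variables (U : set 'rV[R]_n) (oU : open U).
Implicit Types F G : 'rV[R]_n -> R[i].

Lemma csmooth_on_ext F G : (forall x, U x -> F x = G x) ->
  csmooth_on U F -> csmooth_on U G.
Proof.
move=> FG [r j]; split; first by apply: smooth_on_ext r => // x /FG ->.
by apply: smooth_on_ext j => // x /FG ->.
Qed.

Lemma csmooth_on_cst a : csmooth_on U (fun=> a).
Proof. by split; apply: smooth_on_cst. Qed.

Lemma csmooth_onD F G : csmooth_on U F -> csmooth_on U G ->
  csmooth_on U (fun x => F x + G x).
Proof.
move=> [r i] [r' i']; split.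
  by apply: smooth_on_ext (smooth_onD oU r r') => // x _; case: (F x) (G x) => ? ? [].
by apply: smooth_on_ext (smooth_onD oU i i') => // x _; case: (F x) (G x) => ? ? [].
Qed.

Lemma csmooth_onM F G : csmooth_on U F -> csmooth_on U G ->
  csmooth_on U (fun x => F x * G x).
Proof.
move=> [r i] [r' i']; split.
  apply: smooth_on_ext (smooth_onD oU (smooth_onM oU r r') (smooth_onN oU (smooth_onM oU i i'))) => // x _.
  by case: (F x) (G x) => ? ? [].
apply: smooth_on_ext (smooth_onD oU (smooth_onM oU r i') (smooth_onM oU i r')) => // x _.
by case: (F x) (G x) => ? ? [].
Qed.

Lemma csmooth_on_conj F : csmooth_on U F -> csmooth_on U (fun x => (F x)^*).
Proof.
move=> [r i]; split.
  by apply: smooth_on_ext r => // x _; case: (F x).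
by apply: smooth_on_ext (smooth_onN oU i) => // x _; case: (F x).
Qed.

Lemma csmooth_onV F : (forall x, U x -> F x != 0) -> csmooth_on U F ->
  csmooth_on U (fun x => (F x)^-1).
Proof.
move=> F0 [r i].
have n0 x : U x -> complex.Re (F x) * complex.Re (F x) +
    complex.Im (F x) * complex.Im (F x) != 0.
  move=> /F0; case: (F x) => a b; rewrite -!expr2 paddr_eq0 ?sqr_ge0 //=.
  by rewrite !sqrf_eq0 eq_complex /=.
have sn := smooth_onV oU n0
  (smooth_onD oU (smooth_onM oU r r) (smooth_onM oU i i)).
split.
  apply: smooth_on_ext (smooth_onM oU r sn) => // x _.
  by case: (F x) => a b /=; rewrite -!expr2.
apply: smooth_on_ext (smooth_onN oU (smooth_onM oU i sn)) => // x _.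
by case: (F x) => a b /=; rewrite -!expr2 // mulNr.
Qed.

End ComplexSmooth.
End SmoothRn.

Record chart (R : realType) (n : nat) (M : topologicalType) := Chart {
  cdom : set M;
  cmap : M -> 'rV[R]_n;
  cinv : 'rV[R]_n -> M;
  cdom_open : open cdom;
  cimg_open : open (cmap @` cdom);
  cmapK : forall x, cdom x -> cinv (cmap x) = x;
  cmap_continuous : forall x, cdom x -> {for x, continuous cmap};
  cinv_continuous : forall y, (cmap @` cdom) y -> {for y, continuous cinv} }.

Record manifold (R : realType) (n : nat) := Manifold {
  mf_sort :> topologicalType;
  atlas : set (chart R n mf_sort);
  mf_hausdorff : hausdorff_space mf_sort;
  mf_second_countable : @second_countable mf_sort;
  atlas_cover : forall x, exists2 c, atlas c & cdom c x;
  atlas_compat : forall c d, atlas c -> atlas d -> forall j : 'I_n,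
    smooth_on (cmap c @` (cdom c `&` cdom d))
      (fun y => cmap d (cinv c y) ord0 j) }.

Section SmoothManifold.
Variables (R : realType) (n : nat) (M : manifold R n).
Implicit Types (U V : set M) (f g : M -> R[i]).

Definition smooth_fun U f : Prop :=
  forall c, atlas c ->
    csmooth_on (cmap c @` (U `&` cdom c)) (fun y => f (cinv c y)).

Lemma chart_img_open (c : chart R n M) U : open U ->
  open (cmap c @` (U `&` cdom c)).
Proof.
move=> oU; rewrite openE => _ [x [Ux cx] <-].
have cy : (cmap c @` cdom c) (cmap c x) by exists x.
have := cinv_continuous cy; rewrite /prop_for /continuous_at cmapK // => /(_ U) nU.
have nU' : nbhs (cmap c x) (cinv c @^-1` U) by apply: nU; exact: open_nbhs_nbhs.
have nI : nbhs (cmap c x) (cmap c @` cdom c).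
  by apply: open_nbhs_nbhs; split=> //; exact: cimg_open.
apply: filterS (filterI nU' nI) => z [/= Uz [w cw wz]].
by exists w => //; split=> //; rewrite -(cmapK cw) wz.
Qed.

Lemma smooth_fun_local f :
  (forall x, exists U, [/\ open U, U x & smooth_fun U f]) -> smooth_fun setT f.
Proof.
move=> H c ac; split=> _ [x [_ cx] <-] s; have [U [oU Ux sf]] := H x.
  by have [r _] := sf c ac; apply: r; exists x.
by have [_ i] := sf c ac; apply: i; exists x.
Qed.

Lemma smooth_fun_sub U V f : V `<=` U -> smooth_fun U f -> smooth_fun V f.
Proof.
move=> VU sf c ac; have [r i] := sf c ac.
split=> y [x [Vx cx] <-] s; [apply: r|apply: i]; exists x => //;
  split=> //; exact: VU.
Qed.

Section Closure.
Variables (U : set M) (oU : open U).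

Lemma smooth_fun_ext f g : (forall x, U x -> f x = g x) ->
  smooth_fun U f -> smooth_fun U g.
Proof.
move=> fg sf c ac; have := sf c ac.
apply: csmooth_on_ext; first exact: chart_img_open.
by move=> _ [x [Ux cx] <-]; rewrite cmapK //; exact: fg.
Qed.

Lemma smooth_fun_cst a : smooth_fun U (fun=> a).
Proof. by move=> c ac; apply: csmooth_on_cst. Qed.

Lemma smooth_funD f g : smooth_fun U f -> smooth_fun U g ->
  smooth_fun U (fun x => f x + g x).
Proof.
move=> sf sg c ac; have := csmooth_onD _ (sf c ac) (sg c ac).
by apply; exact: chart_img_open.
Qed.

Lemma smooth_funM f g : smooth_fun U f -> smooth_fun U g ->
  smooth_fun U (fun x => f x * g x).
Proof.
move=> sf sg c ac; have := csmooth_onM _ (sf c ac) (sg c ac).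
by apply; exact: chart_img_open.
Qed.

Lemma smooth_fun_conj f : smooth_fun U f -> smooth_fun U (fun x => (f x)^*).
Proof.
move=> sf c ac; have := csmooth_on_conj _ (sf c ac).
by apply; exact: chart_img_open.
Qed.

Lemma smooth_funV f : (forall x, U x -> f x != 0) -> smooth_fun U f ->
  smooth_fun U (fun x => (f x)^-1).
Proof.
move=> f0 sf c ac; have := csmooth_onV _ _ (sf c ac).
apply; first exact: chart_img_open.
by move=> _ [x [Ux cx] <-]; rewrite cmapK //; exact: f0.
Qed.

Lemma smooth_fun_sum (I : Type) (r : seq I) (P : pred I) (F : I -> M -> R[i]) :
  (forall i, smooth_fun U (F i)) ->
  smooth_fun U (fun x => \sum_(i <- r | P i) F i x).
Proof.
move=> sF; elim: r => [|i r IH].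
  apply: smooth_fun_ext (smooth_fun_cst 0) => x _; by rewrite big_nil.
case Pi : (P i).
  apply: smooth_fun_ext (smooth_funD (sF i) IH) => x _.
  by rewrite big_cons Pi.
by apply: smooth_fun_ext IH => x _; rewrite big_cons Pi.
Qed.

Lemma smooth_fun_prod (I : Type) (r : seq I) (P : pred I) (F : I -> M -> R[i]) :
  (forall i, smooth_fun U (F i)) ->
  smooth_fun U (fun x => \prod_(i <- r | P i) F i x).
Proof.
move=> sF; elim: r => [|i r IH].
  apply: smooth_fun_ext (smooth_fun_cst 1) => x _; by rewrite big_nil.
case Pi : (P i).
  apply: smooth_fun_ext (smooth_funM (sF i) IH) => x _.
  by rewrite big_cons Pi.
by apply: smooth_fun_ext IH => x _; rewrite big_cons Pi.
Qed.

Definition smooth_mx m p (A : M -> 'M[R[i]]_(m, p)) : Prop :=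
  forall i j, smooth_fun U (fun x => A x i j).

Lemma smooth_mxM m p q (A : M -> 'M[R[i]]_(m, p)) (B : M -> 'M[R[i]]_(p, q)) :
  smooth_mx A -> smooth_mx B -> smooth_mx (fun x => A x *m B x).
Proof.
move=> sA sB i j.
apply: (@smooth_fun_ext (fun x => \sum_k A x i k * B x k j)) => [x _|].
  by rewrite mxE.
by apply: smooth_fun_sum => k; apply: smooth_funM.
Qed.

Lemma smooth_det m (A : M -> 'M[R[i]]_m) :
  smooth_mx A -> smooth_fun U (fun x => \det (A x)).
Proof.
move=> sA; apply: smooth_fun_sum => s.
by apply: smooth_funM; [exact: smooth_fun_cst|apply: smooth_fun_prod].
Qed.

Lemma smooth_mxV m (A : M -> 'M[R[i]]_m) :
  (forall x, U x -> A x \in unitmx) -> smooth_mx A ->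
  smooth_mx (fun x => invmx (A x)).
Proof.
move=> uA sA i j.
apply: (@smooth_fun_ext (fun x => (\det (A x))^-1 * \adj (A x) i j)) => [x Ux|].
  by rewrite /invmx uA //= !mxE.
apply: smooth_funM.
  apply: smooth_funV; last exact: smooth_det.
  move=> x Ux.
  by rewrite -unitfE -unitmxE uA.
apply: (@smooth_fun_ext (fun x => cofactor (A x) j i)) => [x _|]; first by rewrite mxE.
apply: smooth_funM; first exact: smooth_fun_cst.
apply: smooth_det => a b.
by apply: (@smooth_fun_ext (fun x => A x (lift j a) (lift i b))) => [x _|//]; rewrite !mxE.
Qed.

End Closure.
End SmoothManifold.

(* A local trivialization over [tdom]; [tmap x] and [tinv x] are meaningful   *)
(* only for x in [tdom].                                                      *)
Record trivialization (R : realType) (M : topologicalType)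
    (F : M -> lmodType R[i]) (k : nat) := Trivialization {
  tdom : set M;
  tmap : forall x, F x -> 'cV[R[i]]_k;
  tinv : forall x, 'cV[R[i]]_k -> F x;
  tdom_open : open tdom;
  tmap_linear : forall x, tdom x -> linear (@tmap x);
  tmapK : forall x, tdom x -> cancel (@tmap x) (@tinv x);
  tinvK : forall x, tdom x -> cancel (@tinv x) (@tmap x) }.

(* A smooth complex vector bundle of rank k, given by its fibers and a        *)
(* trivializing cover with smooth transition functions; the smooth structure  *)
(* of the total space is the one determined by that cover.                    *)
Record complexBundle (R : realType) (n : nat) (M : manifold R n) (k : nat) :=
  ComplexBundle {
  fiber :> M -> lmodType R[i];
  trivs : set (trivialization fiber k);
  trivs_cover : forall x, exists2 t, trivs t & tdom t x;
  trivs_compat : forall t t', trivs t -> trivs t' ->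
    forall (v : 'cV[R[i]]_k) (j : 'I_k),
      smooth_fun (tdom t `&` tdom t')
        (fun x => tmap t' (tinv t x v) j ord0) }.

Arguments trivs {R n M k} E : rename.

Record hermitianMetric (R : realType) (n : nat) (M : manifold R n) (k : nat)
    (E : complexBundle M k) := HermitianMetric {
  hm :> forall x, E x -> E x -> R[i];
  hm_linear : forall x (v : E x), scalar (hm v);
  hm_herm : forall x (v w : E x), hm v w = (hm w v)^*;
  hm_pos : forall x (v : E x), v <> 0 -> 0 < hm v v;
  hm_smooth : forall t, trivs E t -> forall v w : 'cV[R[i]]_k,
    smooth_fun (tdom t) (fun x => hm (tinv t x v) (tinv t x w)) }.

Section Support.
Variables (R : realType) (M : topologicalType) (V : M -> lmodType R[i]).

Definition supp (s : forall x, V x) : set M := closure [set x | s x <> 0].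

End Support.

Lemma supp_compactU (R : realType) (M : topologicalType)
    (V V1 V2 : M -> lmodType R[i]) (s : forall x, V x)
    (s1 : forall x, V1 x) (s2 : forall x, V2 x) :
  (forall x, s1 x = 0 -> s2 x = 0 -> s x = 0) ->
  compact (supp s1) -> compact (supp s2) -> compact (supp s).
Proof.
move=> H c1 c2; apply: (subclosed_compact _ (compactU c1 c2)).
  exact: closed_closure.
rewrite /supp -closureU; apply: closureS => x /= sx.
by apply: contrapT => /not_orP[/contrapT s1x /contrapT s2x]; apply: sx; apply: H.
Qed.

Lemma supp_compactS (R : realType) (M : topologicalType)
    (V V1 : M -> lmodType R[i]) (s : forall x, V x) (s1 : forall x, V1 x) :
  (forall x, s1 x = 0 -> s x = 0) -> compact (supp s1) -> compact (supp s).
Proof. by move=> H c1; apply: (supp_compactU _ c1 c1) => x s1x _; apply: H. Qed.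

Lemma supp0_compact (R : realType) (M : topologicalType)
  (V : M -> lmodType R[i]) : compact (supp (fun x => 0 : V x)).
Proof.
rewrite /supp (_ : [set x | _] = set0) ?closure0; first exact: compact0.
by apply/seteqP; split=> x //=.
Qed.

Section CompactlySupported.
Variables (R : realType) (n : nat) (M : manifold R n).

Definition ccfun_pred : set (M -> R[i]^o) :=
  [set f | smooth_fun setT f /\ compact (supp f)].

Lemma ccfun_closed :
  pi_submod_closed (V := fun=> (R[i]^o : lmodType R[i])) ccfun_pred.
Proof.
split.
- by split; [apply: smooth_fun_cst|apply: supp0_compact].
- move=> f g [sf cf] [sg cg]; split; first by apply: smooth_funD => //; exact: openT.
  by apply: (supp_compactU _ cf cg) => x -> ->; rewrite addr0.
- move=> a f [sf cf]; split; last by apply: (supp_compactS _ cf) => x ->; rewrite scaler0.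
  by apply: smooth_funM => //; [exact: openT|exact: smooth_fun_cst].
Qed.

Definition ccfun := piSub ccfun_closed.

Lemma ccfunM_subproof (f g : ccfun) : ccfun_pred (fun x => f x * g x).
Proof.
have [[sf cf] [sg cg]] := (pi_funP f, pi_funP g).
split; first by apply: smooth_funM => //; exact: openT.
by apply: (supp_compactS _ cf) => x ->; rewrite mul0r.
Qed.

Definition ccfun_mul (f g : ccfun) : ccfun :=
  PiSub ccfun_closed (ccfunM_subproof f g).

Lemma ccfun_conj_subproof (f : ccfun) : ccfun_pred (fun x => (f x)^*).
Proof.
have [sf cf] := pi_funP f.
split; first by apply: smooth_fun_conj => //; exact: openT.
by apply: (supp_compactS _ cf) => x ->; rewrite rmorph0.
Qed.

Definition ccfun_conj (f : ccfun) : ccfun :=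
  PiSub ccfun_closed (ccfun_conj_subproof f).

Fact ccfun_mulA : associative ccfun_mul.
Proof. by move=> f g k; apply: piSub_ext => x; apply: mulrA. Qed.
Fact ccfun_mulDl : left_distributive ccfun_mul +%R.
Proof. by move=> f g k; apply: piSub_ext => x; apply: mulrDl. Qed.
Fact ccfun_mulDr : right_distributive ccfun_mul +%R.
Proof. by move=> f g k; apply: piSub_ext => x; apply: mulrDr. Qed.
Fact ccfun_mulZl z f g : ccfun_mul (z *: f) g = z *: ccfun_mul f g.
Proof. by apply: piSub_ext => x; rewrite piSubZE /= scalerAl. Qed.
Fact ccfun_mulZr z f g : ccfun_mul f (z *: g) = z *: ccfun_mul f g.
Proof. by apply: piSub_ext => x; rewrite piSubZE /= scalerAr. Qed.
Fact ccfun_conjK : involutive ccfun_conj.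
Proof. by move=> f; apply: piSub_ext => x; apply: conjCK. Qed.
Fact ccfun_conjD : {morph ccfun_conj : f g / f + g}.
Proof. by move=> f g; apply: piSub_ext => x; apply: rmorphD. Qed.
Fact ccfun_conjZ z f : ccfun_conj (z *: f) = z^* *: ccfun_conj f.
Proof. by apply: piSub_ext => x; apply: rmorphM. Qed.
Fact ccfun_conjM f g :
  ccfun_conj (ccfun_mul f g) = ccfun_mul (ccfun_conj g) (ccfun_conj f).
Proof. by apply: piSub_ext => x /=; rewrite rmorphM mulrC. Qed.

Definition ccfun_algebra : starAlgebra R[i] :=
  StarAlgebra ccfun_mulA ccfun_mulDl ccfun_mulDr ccfun_mulZl ccfun_mulZr
    ccfun_conjK ccfun_conjD ccfun_conjZ ccfun_conjM.

Variables (k : nat) (E : complexBundle M k).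

Definition smooth_section (u : forall x, E x) : Prop :=
  forall t, trivs E t -> forall j : 'I_k,
    smooth_fun (tdom t) (fun x => tmap t (u x) j ord0).

Definition ccsection_pred : set (forall x, E x) :=
  [set u | smooth_section u /\ compact (supp u)].

Definition smooth_endo (A : forall x, E x -> E x) : Prop :=
  forall t, trivs E t -> forall (v : 'cV[R[i]]_k) (j : 'I_k),
    smooth_fun (tdom t) (fun x => tmap t (A x (tinv t x v)) j ord0).

Definition ccendo_pred : set (forall x, E x -> E x) :=
  [set A | [/\ forall x, linear (A x), smooth_endo A
    & compact (supp (V := fun x => ((E x -> E x) : lmodType R[i])) A)]].

Section Linearity.
Variables (t : trivialization E k) (x : M) (tx : tdom t x).

Lemma tmapD v w : tmap t (v + w : E x) = tmap t v + tmap t w.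
Proof. by have := tmap_linear tx 1 v w; rewrite !scale1r. Qed.
Lemma tmap0 : tmap t (0 : E x) = 0.
Proof. by apply: (addrI (tmap t (0 : E x))); rewrite -tmapD !addr0. Qed.
Lemma tmapZ a v : tmap t (a *: v : E x) = a *: tmap t v.
Proof. by have := tmap_linear tx a v 0; rewrite tmap0 !addr0. Qed.
Lemma tinv_linear : linear (@tinv _ _ _ _ t x).
Proof. by move=> a v w; rewrite -[LHS](tmapK tx) -[RHS](tmapK tx) tmap_linear // !tinvK. Qed.

Definition tframe (j : 'I_k) : E x := tinv t x (delta_mx j ord0).

Lemma tframeE (v : E x) : v = \sum_j tmap t v j ord0 *: tframe j.
Proof.
have lin0 : tinv t x 0 = 0 by rewrite -tmap0 tmapK.
have linD : {morph (@tinv _ _ _ _ t x) : a b / a + b}.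
  by move=> a b; have := tinv_linear 1 a b; rewrite !scale1r.
have linZ a w : tinv t x (a *: w) = a *: tinv t x w.
  by have := tinv_linear a w 0; rewrite lin0 !addr0.
rewrite -[LHS](tmapK tx) {1}[tmap t v]matrix_sum_delta.
rewrite (big_morph _ linD lin0); apply: eq_bigr => i _.
by rewrite big_ord1 linZ.
Qed.

End Linearity.

Lemma ccsection_closed : pi_submod_closed ccsection_pred.
Proof.
split.
- split; last exact: supp0_compact.
  move=> t tt j; apply: (@smooth_fun_ext _ _ _ _ (tdom_open t) (fun=> 0)) => [x tx|].
    by rewrite tmap0 // mxE.
  exact: smooth_fun_cst.
- move=> u v [su cu] [sv cv]; split; last by apply: (supp_compactU _ cu cv) => x -> ->; rewrite addr0.
  move=> t tt j; have := smooth_funD (tdom_open t) (su t tt j) (sv t tt j).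
  by apply: (smooth_fun_ext (tdom_open t)) => x tx; rewrite tmapD // mxE.
- move=> a u [su cu]; split; last by apply: (supp_compactS _ cu) => x ->; rewrite scaler0.
  move=> t tt j; have := smooth_funM (tdom_open t) (smooth_fun_cst (tdom t) a) (su t tt j).
  by apply: (smooth_fun_ext (tdom_open t)) => x tx; rewrite tmapZ // mxE.
Qed.

Definition ccsection := piSub ccsection_closed.

Lemma ccendo_closed :
  pi_submod_closed (V := fun x => ((E x -> E x) : lmodType R[i])) ccendo_pred.
Proof.
split.
- split; last exact: supp0_compact.
    by move=> x a v w /=; rewrite scaler0 addr0.
  move=> t tt v j; apply: (@smooth_fun_ext _ _ _ _ (tdom_open t) (fun=> 0)) => [x tx|].
    by rewrite tmap0 // mxE.
  exact: smooth_fun_cst.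
- move=> A B [lA sA cA] [lB sB cB]; split.
  + by move=> x a v w /=; rewrite !fctE lA lB scalerDr addrACA.
  + move=> t tt v j; have := smooth_funD (tdom_open t) (sA t tt v j) (sB t tt v j).
    by apply: (smooth_fun_ext (tdom_open t)) => x tx; rewrite !fctE tmapD // mxE.
  + by apply: (supp_compactU _ cA cB) => x -> ->; rewrite addr0.
- move=> a A [lA sA cA]; split.
  + by move=> x b v w /=; rewrite !fctE lA scalerDr !scalerA mulrC.
  + move=> t tt v j; have := smooth_funM (tdom_open t) (smooth_fun_cst (tdom t) a) (sA t tt v j).
    by apply: (smooth_fun_ext (tdom_open t)) => x tx; rewrite !fctE tmapZ // mxE.
  + by apply: (supp_compactS _ cA) => x ->; rewrite scaler0.
Qed.

Definition ccendo := piSub ccendo_closed.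

Lemma ccendo_linear (A : ccendo) x : linear (A x).
Proof. by have [l _ _] := pi_funP A. Qed.

Definition tmx (t : trivialization E k) (A : forall x, E x -> E x) (x : M) :
    'M[R[i]]_k :=
  \matrix_(i, j) tmap t (A x (tframe t x j)) i ord0.

Lemma tmxE t (A : forall x, E x -> E x) x : linear (A x) -> tdom t x ->
  forall v : E x, tmap t (A x v) = tmx t A x *m tmap t v.
Proof.
move=> lA tx v.
have A0 : A x 0 = 0.
  by have := lA (- 1) (0 : E x) 0; rewrite !scaleN1r oppr0 addr0 => ->; rewrite addNr.
have AD : {morph A x : u w / u + w} by move=> u w; have := lA 1 u w; rewrite !scale1r.
have AZ a u : A x (a *: u) = a *: A x u by have := lA a u 0; rewrite A0 !addr0.
rewrite {1}[v](tframeE tx) (big_morph _ AD A0) (big_morph _ (@tmapD t x tx) (tmap0 tx)).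
apply/colP => i; rewrite summxE mxE; apply: eq_bigr => j _.
by rewrite AZ tmapZ // !mxE mulrC.
Qed.

Lemma smooth_tmx t A : trivs E t -> smooth_endo A -> smooth_mx (tdom t) (tmx t A).
Proof.
move=> tt sA i j; have := sA t tt (delta_mx j ord0) i.
by apply: (smooth_fun_ext (tdom_open t)) => x tx; rewrite mxE.
Qed.

Lemma smooth_section_endo A u : (forall x, linear (A x)) -> smooth_endo A ->
  smooth_section u -> smooth_section (fun x => A x (u x)).
Proof.
move=> lA sA su t tt j; have sm := smooth_tmx tt sA.
have := smooth_mxM (tdom_open t) sm (p := k) (q := 1)
  (B := fun x => tmap t (u x)).
move=> /(_ _ j ord0) H.
apply: (smooth_fun_ext (tdom_open t) _ (H _)) => [x tx|i i'].
  by rewrite tmxE.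
by rewrite (ord1 i'); apply: su.
Qed.

Lemma ccendo_mul_subproof (A B : ccendo) : ccendo_pred (fun x => A x \o B x).
Proof.
have [[lA sA cA] [lB sB cB]] := (pi_funP A, pi_funP B); split.
- by move=> x a v w /=; rewrite lB lA.
- move=> t tt v j; have H := smooth_mxM (tdom_open t)
    (smooth_mxM (tdom_open t) (smooth_tmx tt sA) (smooth_tmx tt sB))
    (q := 1) (B := fun=> v) (fun i j => smooth_fun_cst _ _).
  apply: (smooth_fun_ext (tdom_open t) _ (H j ord0)) => x tx /=.
  by rewrite !tmxE // tinvK // mulmxA.
- apply: (supp_compactS _ cB) => x Bx; apply/funext => v /=.
  rewrite Bx; have := lA x (- 1) 0 0.
  by rewrite !scaleN1r oppr0 addr0 => ->; rewrite addNr.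
Qed.

Definition ccendo_mul (A B : ccendo) : ccendo :=
  PiSub ccendo_closed (ccendo_mul_subproof A B).

Variable h : hermitianMetric E.

Definition fiber_hilbert (x : M) : preHilbert R[i] :=
  PreHilbert (@hm_linear _ _ _ _ _ h x) (@hm_herm _ _ _ _ _ h x)
    (@hm_pos _ _ _ _ _ h x).

Definition gram (t : trivialization E k) (x : M) : 'M[R[i]]_k :=
  \matrix_(i, j) h x (tframe t x i) (tframe t x j).

Definition ctrmx m p (A : 'M[R[i]]_(m, p)) : 'M[R[i]]_(p, m) :=
  map_mx Num.conj A^T.

Lemma ctrmxM m p q (A : 'M[R[i]]_(m, p)) (B : 'M[R[i]]_(p, q)) :
  ctrmx (A *m B) = ctrmx B *m ctrmx A.
Proof. by rewrite /ctrmx trmx_mul map_mxM. Qed.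

Lemma ctrmxK m p : cancel (@ctrmx m p) (@ctrmx p m).
Proof. by move=> A; apply/matrixP => i j; rewrite !mxE conjCK. Qed.

Lemma gramE t x (v w : E x) : tdom t x ->
  h x v w = (ctrmx (tmap t v) *m gram t x *m tmap t w) ord0 ord0.
Proof.
move=> tx.
have sumr (H : preHilbert R[i]) (u : H) (F : 'I_k -> H) :
    ip u (\sum_j F j) = \sum_j ip u (F j).
  by apply: (big_morph (ip u) (@ipDr _ H u) (ip0r u)).
have suml (H : preHilbert R[i]) (u : H) (F : 'I_k -> H) :
    ip (\sum_j F j) u = \sum_j ip (F j) u.
  rewrite ip_herm sumr rmorph_sum; apply: eq_bigr => j _ /=.
  by rewrite -ip_herm.
rewrite -[LHS]/(ip (p := fiber_hilbert x) v w) {1}[w](tframeE tx).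
rewrite [LHS]sumr mxE; apply: eq_bigr => j _.
rewrite [LHS](@ipZr _ (fiber_hilbert x)) mulrC; congr (_ * _).
rewrite {1}[v](tframeE tx) [LHS]suml mxE; apply: eq_bigr => i _.
by rewrite [LHS](@ipZl _ (fiber_hilbert x)) !mxE.
Qed.

Lemma gram_herm t x : ctrmx (gram t x) = gram t x.
Proof. by apply/matrixP => i j; rewrite !mxE -hm_herm. Qed.

Lemma gram_unit t x : tdom t x -> gram t x \in unitmx.
Proof.
move=> tx; rewrite -row_free_unit -kermx_eq0; apply/rowV0P => u /sub_kermxP uG.
apply/eqP; rewrite -[u]ctrmxK; set v := ctrmx u.
have hv : h x (tinv t x v) (tinv t x v) = 0.
  by rewrite (gramE _ _ tx) !tinvK // /v ctrmxK uG mul0mx mxE.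
have v0 : tinv t x v = 0.
  by apply: contrapT => /(@hm_pos _ _ _ _ _ h); rewrite hv ltxx.
have -> : v = 0 by rewrite -(tinvK tx v) v0 tmap0.
by apply/eqP/matrixP => i j; rewrite !mxE conjC0.
Qed.

Lemma smooth_gram t : trivs E t -> smooth_mx (tdom t) (gram t).
Proof.
move=> tt i j; have := hm_smooth h tt (delta_mx i ord0) (delta_mx j ord0).
by apply: (smooth_fun_ext (tdom_open t)) => x tx; rewrite mxE.
Qed.

(* Coordinates of the fiberwise adjoint.                                      *)
Definition adj_tmx t (A : forall x, E x -> E x) x : 'M[R[i]]_k :=
  invmx (gram t x) *m ctrmx (tmx t A x) *m gram t x.

Lemma adj_tmxP t A x (v w : E x) : linear (A x) -> tdom t x ->
  h x (tinv t x (adj_tmx t A x *m tmap t v)) w = h x v (A x w).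
Proof.
move=> lA tx; rewrite !(gramE _ _ tx) tinvK // tmxE // /adj_tmx.
congr (fun_of_matrix _ ord0 ord0).
rewrite !ctrmxM gram_herm ctrmxK !mulmxA; congr (_ *m _).
have -> : ctrmx (invmx (gram t x)) = invmx (gram t x).
  rewrite /ctrmx trmx_inv map_invmx; congr invmx; exact: gram_herm.
by rewrite -!mulmxA mulVmx ?gram_unit // mulmx1.
Qed.

Lemma linear_adjointable (f : forall x, E x -> E x) x :
  linear (f x) -> adjointable (H := fiber_hilbert x) (f x).
Proof.
move=> lf; split=> //; have [t tt tx] := trivs_cover E x.
exists (fun v => tinv t x (adj_tmx t f x *m tmap t v)).
  move=> a v w; rewrite -(tinv_linear tx) tmap_linear //.
  by rewrite mulmxDr scalemxAr.
by move=> v w; apply: adj_tmxP.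
Qed.

Definition fiber_op (A : ccendo) x : adjOp (fiber_hilbert x) :=
  PiSub (adjointable_closed (fiber_hilbert x))
    (linear_adjointable (ccendo_linear A (x := x))).

(* Given by cid, not by coordinates; characterized by endo_adjP.              *)
Definition endo_adj (A : ccendo) x : E x -> E x := adjOp_star (fiber_op A x).

Lemma endo_adjP A x (v w : E x) : h x (endo_adj A v) w = h x v (A x w).
Proof. exact: (adj_funP (fiber_op A x)). Qed.

Lemma endo_adj_coord t A x (v : E x) : tdom t x ->
  tmap t (endo_adj A v) = adj_tmx t A x *m tmap t v.
Proof.
move=> tx; rewrite -[RHS](tinvK tx); congr tmap.
apply: (@ip_inj _ (fiber_hilbert x)) => w.
rewrite [LHS]ip_herm [RHS]ip_herm; congr (_^*).
rewrite [LHS]endo_adjP; symmetry; apply: adj_tmxP => //; exact: ccendo_linear.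
Qed.

Lemma endo_adj_subproof (A : ccendo) : ccendo_pred (endo_adj A).
Proof.
have [lA sA cA] := pi_funP A; split.
- by move=> x; have [] := pi_funP (adjOp_star (fiber_op A x)).
- move=> t tt v j; have sG := smooth_gram tt; have oT := tdom_open t.
  have sT : smooth_mx (tdom t) (fun x => ctrmx (tmx t A x)).
    move=> a b; have := smooth_fun_conj oT (smooth_tmx tt sA b a).
    by apply: (smooth_fun_ext oT) => x tx; rewrite !mxE.
  have sV := smooth_mxV oT (fun x tx => gram_unit tx) sG.
  have H := smooth_mxM oT (smooth_mxM oT (smooth_mxM oT sV sT) sG)
    (q := 1) (B := fun=> v) (fun i j => smooth_fun_cst _ _).
  apply: (smooth_fun_ext oT _ (H j ord0)) => x tx.
  by rewrite endo_adj_coord // tinvK.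
- apply: (supp_compactS _ cA) => x Ax; apply/funext => v.
  apply: (@ip_inj _ (fiber_hilbert x)) => w.
  rewrite [LHS]ip_herm [X in X^*]endo_adjP Ax.
  by rewrite [X in X^*](@ip0r _ (fiber_hilbert x)) conjC0 [RHS](@ip0r _ (fiber_hilbert x)).
Qed.

Definition ccendo_star (A : ccendo) : ccendo :=
  PiSub ccendo_closed (endo_adj_subproof A).

Lemma ccendo_ext (A B : ccendo) :
  (forall x (v w : E x), h x v (A x w) = h x v (B x w)) -> A = B.
Proof.
move=> AB; apply: piSub_ext => x; apply/funext => w.
by apply: (@ip_inj _ (fiber_hilbert x)) => v; apply: AB.
Qed.

Lemma hm_starr (A : ccendo) x (v w : E x) :
  h x v (ccendo_star A x w) = h x (A x v) w.
Proof. by rewrite hm_herm [X in X^*]endo_adjP -hm_herm. Qed.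

Lemma hm_starl (A : ccendo) x (v w : E x) :
  h x (ccendo_star A x v) w = h x v (A x w).
Proof. exact: endo_adjP. Qed.

Lemma hmDr x (u v w : E x) : h x u (v + w) = h x u v + h x u w.
Proof. exact: (@ipDr _ (fiber_hilbert x)). Qed.
Lemma hmDl x (u v w : E x) : h x (u + v) w = h x u w + h x v w.
Proof. exact: (@ipDl _ (fiber_hilbert x)). Qed.
Lemma hmZr x a (u v : E x) : h x u (a *: v) = a * h x u v.
Proof. exact: (@ipZr _ (fiber_hilbert x)). Qed.
Lemma hmZl x a (u v : E x) : h x (a *: u) v = a^* * h x u v.
Proof. exact: (@ipZl _ (fiber_hilbert x)). Qed.
Lemma hm0r x (u : E x) : h x u 0 = 0.
Proof. exact: (@ip0r _ (fiber_hilbert x)). Qed.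

Lemma ccendoD (A : ccendo) x (v w : E x) : A x (v + w) = A x v + A x w.
Proof. by have := ccendo_linear A 1 v w; rewrite !scale1r. Qed.
Lemma ccendo0 (A : ccendo) x : A x 0 = 0.
Proof. by apply: (addrI (A x 0)); rewrite -ccendoD !addr0. Qed.
Lemma ccendoZ (A : ccendo) x a (v : E x) : A x (a *: v) = a *: A x v.
Proof. by have := ccendo_linear A a v 0; rewrite ccendo0 !addr0. Qed.

Fact ccendo_mulA : associative ccendo_mul.
Proof. by move=> A B D; apply: piSub_ext. Qed.
Fact ccendo_mulDl : left_distributive ccendo_mul +%R.
Proof. by move=> A B D; apply: piSub_ext. Qed.
Fact ccendo_mulDr : right_distributive ccendo_mul +%R.
Proof.
move=> A B D; apply: piSub_ext => x; apply/funext => v.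
by rewrite -[LHS]/(A x (B x v + D x v)) ccendoD.
Qed.
Fact ccendo_mulZl z A B : ccendo_mul (z *: A) B = z *: ccendo_mul A B.
Proof. exact: piSub_ext. Qed.
Fact ccendo_mulZr z A B : ccendo_mul A (z *: B) = z *: ccendo_mul A B.
Proof.
apply: piSub_ext => x; apply/funext => v.
by rewrite -[LHS]/(A x (z *: B x v)) ccendoZ.
Qed.
Fact ccendo_starK : involutive ccendo_star.
Proof. by move=> A; apply: ccendo_ext => x v w; rewrite hm_starr hm_starl. Qed.
Fact ccendo_starD : {morph ccendo_star : A B / A + B}.
Proof.
move=> A B; apply: ccendo_ext => x v w; rewrite hm_starr.
rewrite -[LHS]/(h x (A x v + B x v) w).
rewrite -[RHS]/(h x v (ccendo_star A x w + ccendo_star B x w)).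
by rewrite hmDl hmDr !hm_starr.
Qed.
Fact ccendo_starZ z A : ccendo_star (z *: A) = z^* *: ccendo_star A.
Proof.
apply: ccendo_ext => x v w; rewrite hm_starr.
rewrite -[LHS]/(h x (z *: A x v) w) -[RHS]/(h x v (z^* *: ccendo_star A x w)).
by rewrite hmZl hmZr hm_starr.
Qed.
Fact ccendo_starM A B :
  ccendo_star (ccendo_mul A B) = ccendo_mul (ccendo_star B) (ccendo_star A).
Proof.
apply: ccendo_ext => x v w; rewrite hm_starr.
by rewrite -[RHS]/(h x v (ccendo_star B x (ccendo_star A x w))) !hm_starr.
Qed.

Definition ccendo_algebra : starAlgebra R[i] :=
  StarAlgebra ccendo_mulA ccendo_mulDl ccendo_mulDr ccendo_mulZl ccendo_mulZr
    ccendo_starK ccendo_starD ccendo_starZ ccendo_starM.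

Lemma endo_act_subproof (A : ccendo) (u : ccsection) :
  ccsection_pred (fun x => A x (u x)).
Proof.
have [[lA sA cA] [su cu]] := (pi_funP A, pi_funP u); split.
  exact: smooth_section_endo.
by apply: (supp_compactS _ cu) => x ->; rewrite ccendo0.
Qed.

Definition endo_act (A : ccendo) (u : ccsection) : ccsection :=
  PiSub ccsection_closed (endo_act_subproof A u).

Lemma fun_act_subproof (u : ccsection) (f : ccfun) :
  ccsection_pred (fun x => (f x : R[i]) *: u x).
Proof.
have [[su cu] [sf cf]] := (pi_funP u, pi_funP f); split.
  move=> t tt j; have oT := tdom_open t.
  have := smooth_funM oT (smooth_fun_sub (@subsetT _ (tdom t)) sf) (su t tt j).
  by apply: (smooth_fun_ext oT) => x tx; rewrite tmapZ // mxE.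
by apply: (supp_compactS _ cu) => x ->; rewrite scaler0.
Qed.

Definition fun_act (u : ccsection) (f : ccfun) : ccsection :=
  PiSub ccsection_closed (fun_act_subproof u f).

Fact endo_act_linearl u : linear (endo_act^~ u).
Proof. by move=> a A B; apply: piSub_ext. Qed.
Fact endo_act_linearr A : linear (endo_act A).
Proof. by move=> a u v; apply: piSub_ext => x; apply: ccendo_linear. Qed.
Fact fun_act_linearl f : linear (fun_act^~ f).
Proof.
move=> a u v; apply: piSub_ext => x; rewrite piSubDE piSubZE /=.
by rewrite scalerDr !scalerA mulrC.
Qed.
Fact fun_act_linearr u : linear (fun_act u).
Proof.
move=> a f g; apply: piSub_ext => x; rewrite piSubDE piSubZE /=.
by rewrite scalerDl scalerA.
Qed.
Fact endo_actM A B u : endo_act (ccendo_mul A B) u = endo_act A (endo_act B u).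
Proof. exact: piSub_ext. Qed.
Fact fun_actM u f g : fun_act u (ccfun_mul f g) = fun_act (fun_act u f) g.
Proof. by apply: piSub_ext => x /=; rewrite scalerA mulrC. Qed.
Fact endo_fun_act A u f : endo_act A (fun_act u f) = fun_act (endo_act A u) f.
Proof. by apply: piSub_ext => x /=; rewrite ccendoZ. Qed.

Definition section_bimodule : bimodule ccendo_algebra ccfun_algebra :=
  @Bimodule _ ccendo_algebra ccfun_algebra ccsection endo_act fun_act
    endo_act_linearl endo_act_linearr fun_act_linearl fun_act_linearr
    endo_actM fun_actM endo_fun_act.

Lemma smooth_hm t (u v : forall x, E x) : trivs E t ->
  (forall j, smooth_fun (tdom t) (fun x => tmap t (u x) j ord0)) ->
  (forall j, smooth_fun (tdom t) (fun x => tmap t (v x) j ord0)) ->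
  smooth_fun (tdom t) (fun x => h x (u x) (v x)).
Proof.
move=> tt su sv; have oT := tdom_open t.
have s1 : smooth_mx (tdom t) (fun x => ctrmx (tmap t (u x))).
  move=> a b; have := smooth_fun_conj oT (su b).
  by apply: (smooth_fun_ext oT) => x tx; rewrite !mxE (ord1 a).
have s2 : smooth_mx (tdom t) (fun x => tmap t (v x)).
  by move=> a b; rewrite (ord1 b).
have := smooth_mxM oT (smooth_mxM oT s1 (smooth_gram tt)) s2 ord0 ord0.
by apply: (smooth_fun_ext oT) => x tx; rewrite (gramE _ _ tx).
Qed.

Lemma section_metric_subproof (u v : ccsection) :
  ccfun_pred (fun x => h x (u x) (v x)).
Proof.
have [[su cu] [sv cv]] := (pi_funP u, pi_funP v); split.
  apply: smooth_fun_local => x; have [t tt tx] := trivs_cover E x.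
  exists (tdom t); split=> //; first exact: tdom_open.
  by apply: (smooth_hm tt) => j; [apply: su|apply: sv].
by apply: (supp_compactS _ cv) => x ->; rewrite hm0r.
Qed.

Definition section_metric (u v : ccsection) : ccfun :=
  PiSub ccfun_closed (section_metric_subproof u v).

Lemma section_theta_subproof (u v : ccsection) :
  ccendo_pred (fun x w => h x (v x) w *: u x).
Proof.
have [[su cu] [sv cv]] := (pi_funP u, pi_funP v); split.
- by move=> x a w w'; rewrite hm_linear scalerDl scalerA.
- move=> t tt w j; have oT := tdom_open t.
  have sw i : smooth_fun (tdom t) (fun x => tmap t (tinv t x w) i ord0).
    apply: (smooth_fun_ext oT _ (smooth_fun_cst _ (w i ord0))) => x tx.
    by rewrite tinvK.
  have := smooth_funM oT (smooth_hm tt (sv t tt) sw) (su t tt j).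
  by apply: (smooth_fun_ext oT) => x tx; rewrite tmapZ // mxE.
- by apply: (supp_compactS _ cu) => x ->; apply/funext => w; rewrite scaler0.
Qed.

Definition section_theta (u v : ccsection) : ccendo :=
  PiSub ccendo_closed (section_theta_subproof u v).

End CompactlySupported.

(* Main.v *)
(* Over a compact set K there are finitely many compactly supported sections  *)
(* w and a smooth function phi >= 0, positive on K, such that on all of M     *)
(*   sum_w Theta_{w,w} = phi id    and    sum_w h(w,w) = k phi:               *)
(* multiply local orthonormal frames (from a Cholesky decomposition of the    *)
(* Gram matrix) by bump functions. Fullness follows from                      *)
(*   f = sum_w h(w, w f / (k phi))  and  A = sum_w Theta_{(A/phi) w, w}       *)
(* with K the support of f, resp. A. Positivity, P and Q all follow from the  *)
(* following decompositions, for finitely many sections u, v supported in K:  *)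
(*   h(u,v) = sum_w h(w,u')^* h(w,v')           with u' = u / sqrt phi,       *)
(*   Theta_{u,v} = sum_w Theta_{w,u'}^* Theta_{w,v'}                          *)
(*                                              with u' = u / sqrt(k phi).    *)

Require Import Defs.
From mathcomp Require Import all_boot all_order all_algebra complex.
From mathcomp Require Import boolp classical_sets functions reals topology.
From mathcomp Require Import normedtype sequences derive realfun exp.
From mathcomp Require Import ring lra.

Set Implicit Arguments.
Unset Strict Implicit.
Unset Printing Implicit Defensive.

Import Order.TTheory GRing.Theory Num.Theory.
Import numFieldNormedType.Exports.

Local Open Scope classical_set_scope.
Local Open Scope ring_scope.

(** * Compactness and composition with functions of one variable *)

(** In an orthonormal frame a fiber is C^k, and the statement becomes the familiar equivalence
    between k x k matrices and scalars. The algebraic axioms are identities in a single fiber;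
    fullness and positivity are the global part. If M is not compact neither algebra need have a
    unit, but each of these claims involves only finitely many compactly supported objects. So it is
    enough to resolve the identity over a compact set, up to a factor phi that is positive there:
    this is [tight_frame], obtained by cutting off the frames of [orthonormal_frame] with
    [bump_function] and adding over a finite cover.

    Dividing by phi gives [full_theta]; the trace of the resolution is k phi, and dividing by it,
    possible as k >= 1, gives [full_metric]. Dividing sections by a square root instead turns the
    same two identities into sums of squares ([sum_of_squares_metric], [sum_of_squares_theta]). A
    sum of squares lies in the positive cone ([sum_of_squares_cone]), and a representation maps it
    to a sum of squared norms, whence P and Q ([sum_of_squares_property_P]). The analysis needed,
    smoothness of exp(-1/t) and of square roots, rests on [smooth_on_comp]. *)

Lemma compact_ind (T : topologicalType) (P : set T -> Prop) (K : set T) :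
  compact K -> P set0 -> (forall A B, A `<=` B -> P B -> P A) ->
  (forall A B, P A -> P B -> P (A `|` B)) ->
  (forall x, K x -> exists2 N, nbhs x N & P N) -> P K.
Proof.
move=> cK P0 PS PU Pn; apply: contrapT => nPK.
(* If [P K] fails, the sets whose complement in K satisfies P form a proper filter containing K. A
   cluster point of it in K has a neighbourhood N with P N, so the complement of N belongs to the
   filter and yet would have to meet N. *)
pose F := [set B : set T | P (K `\` B)].
have FF : ProperFilter F.
  split; first by rewrite /F /= setD0.
  split.
  - by rewrite /F /= setDT.
  - by move=> A B FA FB; apply: PS (PU _ _ FA FB); rewrite setDIr.
  - by move=> A B AB; apply: PS => x [Kx nB]; split=> // /AB.
have FK : F K by rewrite /F /= setDv.
have [p [Kp clp]] := cK F FF FK.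
have [N nN PN] := Pn p Kp.
have [|q [nq Nq]] := clp (~` N) N _ nN.
  by apply: PS PN => x [_ /contrapT].
exact: nq.
Qed.

Section RealComposition.
Variables (R : realType) (n : nat).
Implicit Types (U : set 'rV[R]_n) (g : 'rV[R]_n -> R).

(** The one-variable chain rule along the line through x in direction v. *)
Lemma is_derive_comp1 (f : R -> R) g x v a b :
  is_derive (g x) 1 f a -> is_derive x v g b ->
  is_derive x v (fun y => f (g y)) (a * b).
Proof.
have DE (u : 'rV[R]_n -> R) : 'D_v u x = 'D_1 (fun h : R => u (h *: v + x)) 0.
  rewrite /derive; set q1 := fun h => h^-1 *: _; set q2 := fun h => h^-1 *: _.
  suff -> : q1 = q2 by [].
  by apply/funext => h; rewrite /q1 /q2 /= addr0 scale0r add0r [_%:A]mulr1.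
move=> df dg.
have dg1 : is_derive (0 : R) 1 (fun h : R => g (h *: v + x)) b.
  by have [d <-] := dg; split; [exact: (derivable1P g x v).1|rewrite -DE].
have dfg : is_derive (0 : R) 1 (f \o (fun h : R => g (h *: v + x))) (a * b).
  by apply: is_derive1_comp; rewrite scale0r add0r.
by have [d <-] := dfg; split; [exact/(derivable1P (f \o g)) | rewrite DE].
Qed.

(** Induction on the order of differentiability with f ranging over all of P: a partial derivative
    of f(g) is f'(g) times one of g, and f' is again in P. *)
Lemma smooth_on_comp (P : set (R -> R)) (V : set R) U g rho :
  (forall f, P f ->
     exists2 f', P f' & forall t, V t -> is_derive t 1 f (f' t)) ->
  open U -> (forall x, U x -> V (g x)) -> P rho ->
  smooth_on U g -> smooth_on U (fun x => rho (g x)).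
Proof.
move=> dP oU gV Pr /smooth_onP sg; apply/smooth_onP => k.
have cont f : P f -> forall x, U x -> {for x, continuous (fun x => f (g x))}.
  move=> Pf x Ux; have [f' _ df] := dP f Pf.
  apply: (@continuous_comp _ _ _ g f); first exact: (sg 0%N).1.
  by apply/differentiable_continuous/derivable1_diffP;
    have [] := df _ (gV x Ux).
elim: k rho Pr => [|k IH] f Pf; first by split=> //; exact: cont.
split=> [|i]; first exact: cont.
have [f' Pf' df] := dP f Pf.
have [_ /(_ i) [dg cg]] := sg k.+1.
have dfg x : U x ->
    is_derive x 'e_i (fun x => f (g x)) (f' (g x) * 'D_'e_i g x).
  by move=> Ux; apply: is_derive_comp1; [exact/df/gV|exact/derivableP/dg].
split=> [x Ux|]; first by have [] := dfg x Ux.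
apply: Ck_ext (CkM oU (IH _ Pf') cg) => // x Ux.
by have [_ ->] := dfg x Ux.
Qed.

Lemma smooth_on_sqrt U g : open U -> (forall x, U x -> 0 < g x) ->
  smooth_on U g -> smooth_on U (fun x => Num.sqrt (g x)).
Proof.
move=> oU g0.
(* The functions c t^(1/2 - m) on t > 0 are closed under differentiation, which replaces c by c (1/2
   - m) and m by m + 1. *)
apply: (@smooth_on_comp
  [set f | exists c m, f = fun t => c * (Num.sqrt t * t^-1 ^+ m)]
  [set t | 0 < t]) => // [f [c [m ->]]|]; last first.
  by exists 1, 0%N; apply/funext => t; rewrite expr0 mul1r mulr1.
exists (fun t => (c * (2^-1 - m%:R)) * (Num.sqrt t * t^-1 ^+ m.+1)).
  by exists (c * (2^-1 - m%:R)), m.+1.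
move=> t /= t0; have tn0 : t != 0 by rewrite gt_eqF.
have ds := is_derive1_sqrt t0.
have di : is_derive t 1 (fun y : R => y^-1) (- t ^- 2 *: 1).
  exact: (@is_deriveV _ id).
have D := is_deriveZ c (is_deriveM ds (is_deriveX m di)).
have -> : (fun t => c * (Num.sqrt t * t^-1 ^+ m)) =
    c \*: (Num.sqrt * (fun y => y^-1) ^+ m).
  by apply/funext => y; rewrite /= !fctE.
apply: (is_derive_eq D).
rewrite fctE /GRing.scale /= !mulr1.
have sn0 : Num.sqrt t != 0 by rewrite sqrtr_eq0 -ltNge.
have -> : (2 * Num.sqrt t)^-1 = 2^-1 * (Num.sqrt t * t^-1).
  by rewrite -{3}(sqr_sqrtr (ltW t0)); field; rewrite sn0.
case: m {D} => [|m] /=; first by rewrite expr0 expr1; field.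
by rewrite -exprVn !exprS; ring.
Qed.

End RealComposition.

(** * Functions flat at the origin *)

Section FlatFunctions.
Variable R : realType.
Implicit Types (p : {poly R}) (s t : R).

Lemma is_derive0_quadratic (f : R -> R) (c : R) :
  (forall h, `|h| <= 1 -> `|f h| <= c * h ^+ 2) -> is_derive (0 : R) 1 f 0.
Proof.
move=> fc.
have f0 : f 0 = 0.
  by have := fc 0; rewrite normr0 ler01 expr0n mulr0 normr_le0 => /(_ isT)/eqP.
have L : (fun h => h^-1 *: ((f \o shift 0) (h *: 1) - f 0)) @ 0^' --> (0 : R).
  apply/cvgr0Pnorm_le => e e0; near=> h.
  have h0 : h != 0 by near: h; exact: nbhs_dnbhs_neq.
  have h1 : `|h| <= 1 by near: h; apply: dnbhs0_le.
  have he : `|h| <= e / (`|c| + 1).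
    by near: h; apply: dnbhs0_le; rewrite divr_gt0 // ltr_wpDl.
  rewrite /= addr0 f0 subr0 [h *: 1]mulr1 normrZ normfV.
  rewrite ler_pdivrMl ?normr_gt0 //; apply: le_trans (fc h h1) _.
  rewrite -real_normK ?num_real // expr2 mulrCA ler_wpM2l //.
  have c1 : 0 < `|c| + 1 by rewrite ltr_wpDl.
  move: he; rewrite ler_pdivlMr // => he.
  apply: le_trans he; rewrite mulrC ler_wpM2l // ler_wpDr //.
  exact: ler_norm.
by split; [apply/cvg_ex; exists 0 | apply/cvg_lim].
Unshelve. all: by end_near. Qed.

(* The polynomial factor makes the family closed under differentiation.       *)
Definition flat p s : R := if 0 < s then p.[s^-1] * expR (- s^-1) else 0.

(** For 0 < h <= 1 put y = 1/h, m = [size p] and let S be the sum of the moduli of the coefficients.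
    Then |p(y)| <= S y^m, while a single term of the exponential series gives exp(-y) <= (m+2)! /
    y^(m+2). *)
Lemma flat_bound p :
  exists c, forall h, `|h| <= 1 -> `|flat p h| <= c * h ^+ 2.
Proof.
pose m := size p.
exists ((\sum_(i < m) `|p`_i|) * m.+2`!%:R) => h h1.
have S0 : 0 <= \sum_(i < m) `|p`_i| by apply: sumr_ge0.
rewrite /flat; case: ifPn => h0; last first.
  by rewrite normr0 mulr_ge0 ?sqr_ge0 // mulr_ge0.
have y1 : 1 <= h^-1.
  by rewrite invf_ge1 //; apply: le_trans (ler_norm h) h1.
set y := h^-1 in y1 *; have y0 : 0 < y by rewrite invr_gt0.
have Ep : `|p.[y]| <= (\sum_(i < m) `|p`_i|) * y ^+ m.
  rewrite horner_coef mulr_suml; apply: le_trans (ler_norm_sum _ _ _) _.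
  apply: ler_sum => i _; rewrite normrM ler_wpM2l //.
  rewrite ger0_norm ?ler_weXn2l 1?ltnW //.
  by rewrite exprn_ge0 // ltW.
have Ee : expR (- y) <= m.+2`!%:R * (y ^+ m.+2)^-1.
  rewrite expRN -[leRHS]invrK invfM invrK lef_pV2 ?posrE ?expR_gt0 //; last 1 first.
    by rewrite mulr_gt0 ?exprn_gt0 // invr_gt0 ltr0n fact_gt0.
  rewrite mulrC; apply: le_trans (expR_ge1Dxn m.+1 (ltW y0)).
  by rewrite ler_wpDl.
rewrite normrM (ger0_norm (expR_ge0 _)).
apply: le_trans (ler_pM (normr_ge0 _) (expR_ge0 _) Ep Ee) _.
rewrite -!mulrA ler_wpM2l // mulrCA ler_wpM2l ?ler0n //.
rewrite -[h]invrK -/y le_eqVlt -addn2 exprD; apply/orP; left; apply/eqP.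
by field; rewrite expf_neq0 gt_eqF.
Qed.

(** For t > 0 the inner derivative -1/t^2 accounts for the factor X^2. At 0 the quadratic bound of
    [flat_bound] forces the derivative to vanish. *)
Lemma is_derive_flat p t :
  is_derive t 1 (flat p) (flat ('X^2 * (p - p^`())) t).
Proof.
have [t0|t0|->] := ltgtP t 0.
- have -> : flat ('X^2 * (p - p^`())) t = 0 by rewrite /flat ltNge ltW.
  apply: (@near_eq_is_derive _ _ _ (fun=> 0)).
  near=> s; rewrite /flat ltNge ltW //; near: s; exact: lt_nbhsl.
- have tn0 : t != 0 by rewrite gt_eqF.
  apply: (@near_eq_is_derive _ _ _
    ((horner p \o GRing.inv) * (expR \o (- (@GRing.inv R))))).
    by near=> s; rewrite /flat ifT //; near: s; exact: lt_nbhsr.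
  have di : is_derive t 1 (@GRing.inv R) (- t ^- 2 *: 1).
    exact: (@is_deriveV _ id).
  have dp := is_derive1_comp (is_derive_poly p t^-1) di.
  have de := is_derive1_comp (is_derive_expR ((- @GRing.inv R) t))
    (is_deriveN di).
  apply: (is_derive_eq (is_deriveM dp de)).
  rewrite /flat t0 !hornerE /GRing.scale /= !mulr1 -exprVn; ring.
- rewrite {2}/flat ltxx; have [c] := flat_bound p; exact: is_derive0_quadratic.
Unshelve. all: by end_near. Qed.

Lemma smooth_on_flat n (U : set 'rV[R]_n) (g : 'rV[R]_n -> R) : open U ->
  smooth_on U g -> smooth_on U (fun x => flat 1 (g x)).
Proof.
move=> oU.
apply: (smooth_on_comp (P := range flat) (V := setT)) oU _ _ => //.
move=> _ [p _ <-]; exists (flat ('X^2 * (p - p^`()))); last first.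
  by move=> t _; exact: is_derive_flat.
by exists ('X^2 * (p - p^`())).
Qed.

End FlatFunctions.

(** * Smooth functions and bump functions on a manifold *)

Section SmoothFunctions.
Variables (R : realType) (n : nat) (M : manifold R n).
Implicit Types (U V : set M) (f : M -> R[i]).

Lemma smooth_funU U V f :
  smooth_fun U f -> smooth_fun V f -> smooth_fun (U `|` V) f.
Proof.
move=> sU sV c ac; have [rU iU] := sU c ac; have [rV iV] := sV c ac.
by split=> _ [x [[Ux|Vx] cx] <-];
  [apply: rU|apply: rV|apply: iU|apply: iV]; exists x.
Qed.

Lemma smooth_fun_neq0 f x : smooth_fun setT f -> f x != 0 ->
  nbhs x [set y | f y != 0].
Proof.
move=> sf fx; have [c ac cx] := atlas_cover x.
have [sr si] := sf c ac.
have Ix : (cmap c @` (setT `&` cdom c)) (cmap c x) by exists x.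
have near0 (g : 'rV[R]_n -> R) : {for cmap c x, continuous g} ->
    g (cmap c x) != 0 -> nbhs x [set y | g (cmap c y) != 0].
  move=> cg g0.
  apply: (@cvgr_neq0 _ _ _ _ (nbhs_filter x) _ (g (cmap c x))) => //.
  exact: (continuous_comp (cmap_continuous cx) cg).
have nc : nbhs x (cdom c).
  by apply: open_nbhs_nbhs; split=> //; exact: cdom_open.
have [re0|re0] := eqVneq (complex.Re (f x)) 0; last first.
  have := near0 _ (sr _ Ix [::]).1; rewrite /= cmapK // => /(_ re0) H.
  apply: filterS (filterI nc H) => y [cy /=].
  by rewrite cmapK //; apply: contra_neq => ->.
have im0 : complex.Im (f x) != 0.
  by apply: contra_neq fx => im0; apply/eqP; rewrite eq_complex re0 im0 !eqxx.
have := near0 _ (si _ Ix [::]).1; rewrite /= cmapK // => /(_ im0) H.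
apply: filterS (filterI nc H) => y [cy /=].
by rewrite cmapK //; apply: contra_neq => ->.
Qed.

Lemma smooth_fun_real U (f : M -> R) :
  (forall c, atlas c ->
    smooth_on (cmap c @` (U `&` cdom c)) (fun y => f (cinv c y))) ->
  smooth_fun U (fun x => (f x)%:C%C).
Proof. by move=> sf c ac; split; [exact: sf|exact: smooth_on_cst]. Qed.

Lemma smooth_fun_sqrt U (f : M -> R) : open U -> (forall x, U x -> 0 < f x) ->
  smooth_fun U (fun x => (f x)%:C%C) ->
  smooth_fun U (fun x => (Num.sqrt (f x))%:C%C).
Proof.
move=> oU f0 sf; apply: smooth_fun_real => c ac; have [sr _] := sf c ac.
apply: smooth_on_sqrt sr; first exact: chart_img_open.
by move=> _ [x [Ux cx] <-]; rewrite cmapK //; exact: f0.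
Qed.

(** In a chart around x with image a, compose exp(-1/t) with r^2 - |v - a|^2. This is nonzero only
    on a Euclidean ball inside the closed cube B of half-side r, half the radius of a sup-norm ball
    contained in the chart image of U. *)
Lemma bump_function U x : open U -> U x ->
  exists chi : M -> R, [/\ smooth_fun setT (fun y => (chi y)%:C%C),
    chi x != 0
    & exists K, [/\ compact K, K `<=` U & forall y, chi y != 0 -> K y]].
Proof.
move=> oU Ux; have [c ac cx] := atlas_cover x; pose a := cmap c x.
have oW := chart_img_open (c := c) oU; set W := cmap c @` _ in oW.
have /nbhs_ballP[e /= e0 eW] : nbhs a W.
  by apply: open_nbhs_nbhs; split=> //; exists x.
pose r := e / 2; have r0 : 0 < r by rewrite divr_gt0.
pose I i := `[a ord0 i - r, a ord0 i + r]%classic.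
pose B := [set v : 'rV[R]_n | forall i, I i (v ord0 i)].
have cB : compact B.
  by apply: (@rV_compact R n I) => i; exact: segment_compact.
have BW : B `<=` W.
  move=> v Bv; apply: eW; split=> // i j; rewrite (ord1 i) /ball /=.
  have := Bv j; rewrite /I /= in_itv /= => /andP[lo hi].
  rewrite /ball_ ltr_distl; rewrite /r in lo hi.
  by apply/andP; split; lra.
have WK v : W v -> [/\ U (cinv c v), cdom c (cinv c v) & cmap c (cinv c v) = v].
  by move=> [y [Uy cy] <-]; rewrite cmapK.
pose K := cinv c @` B.
have cK : compact K.
  apply: continuous_compact cB; apply: continuous_in_subspaceT => v.
  rewrite inE => /BW [y [Uy cy] <-]; apply: cinv_continuous; by exists y.
pose q (v : 'rV[R]_n) : R := r ^+ 2 - \sum_i (v ord0 i - a ord0 i) ^+ 2.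
pose chi y : R := if `[< cdom c y >] then flat 1 (q (cmap c y)) else 0.
have chiK y : chi y != 0 -> K y.
  rewrite /chi; case: asboolP => cy; last by rewrite eqxx.
  rewrite /flat; case: ifP => q0; last by rewrite eqxx.
  move=> _; exists (cmap c y); last exact: cmapK.
  move=> i; rewrite /I /= in_itv /=.
  have : (cmap c y ord0 i - a ord0 i) ^+ 2 <= r ^+ 2.
    move: q0; rewrite subr_gt0 (bigD1 i) //= => /ltW; apply: le_trans.
    by rewrite ler_wpDr // sumr_ge0 // => j _; rewrite sqr_ge0.
  move=> /ler_wsqrtr; rewrite !sqrtr_sqr (gtr0_norm r0) ler_distl.
  by move=> /andP[-> ->].
exists chi; split.
(* Two open sets cover M: the chart domain, where chi is the explicit formula, and the complement of
   K, where chi is 0. K is closed because M is Hausdorff. *)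
- have -> : [set: M] = cdom c `|` ~` K.
    apply/seteqP; split=> // y _; have [Ky|] := pselect (K y); last by right.
    by left; case: Ky => v /BW/WK[_ cv _] <-.
  have oK : open (~` K).
    by apply: closed_openC; apply: compact_closed cK; exact: mf_hausdorff.
  apply: smooth_funU; last first.
    apply: (@smooth_fun_ext _ _ _ _ oK (fun=> 0)); last exact: smooth_fun_cst.
    move=> y nK; rewrite (_ : chi y = 0) //; apply: contrapT => /eqP.
    by move=> /chiK.
  apply: smooth_fun_real => d ad.
  have oI := chart_img_open (c := d) (cdom_open c).
  have sq : smooth_on (cmap d @` (cdom c `&` cdom d))
      (fun y => q (cmap c (cinv d y))).
    apply: smooth_onD => //; first exact: smooth_on_cst.
    apply: smooth_onN => //.
    elim: (index_enum _) => [|i s IH].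
      by apply: (smooth_on_ext oI _ (smooth_on_cst 0)) => y _; rewrite big_nil.
    have si := atlas_compat ad ac i; rewrite setIC in si.
    have sc := smooth_onD oI si (smooth_on_cst (- a ord0 i)).
    apply: (smooth_on_ext oI _ (smooth_onD oI (smooth_onM oI sc sc) IH)) => y _.
    by rewrite big_cons expr2.
  apply: (smooth_on_ext oI _ (smooth_on_flat oI sq)) => _ [z [cz dz] <-].
  by rewrite cmapK // /chi; case: asboolP.
- rewrite /chi; case: asboolP => // _; rewrite /flat /q.
  rewrite big1 => [|i _]; last by rewrite subrr expr0n.
  by rewrite subr0 exprn_gt0 // hornerC mul1r gt_eqF ?expR_gt0.
- by exists K; split=> // y [v /BW/WK[Uv _ _] <-].
Qed.

End SmoothFunctions.

(** * Smooth Cholesky decomposition *)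

Section Cholesky.
Variables (R : realType) (n : nat) (M : manifold R n).

Lemma ctrmxD m p (A B : 'M[R[i]]_(m, p)) : ctrmx (A + B) = ctrmx A + ctrmx B.
Proof. by rewrite /ctrmx linearD map_mxD. Qed.

Lemma ctrmxZ m p a (A : 'M[R[i]]_(m, p)) : ctrmx (a *: A) = a^* *: ctrmx A.
Proof. by rewrite /ctrmx linearZ map_mxZ. Qed.

Lemma ctrmx_delta m p i j :
  ctrmx (delta_mx i j : 'M[R[i]]_(m, p)) = delta_mx j i.
Proof.
apply/matrixP => a b; rewrite !mxE andbC.
by case: (_ && _); rewrite /= ?conjC1 ?conjC0.
Qed.

Lemma ctrmx_col m1 m2 p (A : 'M[R[i]]_(m1, p)) (B : 'M[R[i]]_(m2, p)) :
  ctrmx (col_mx A B) = row_mx (ctrmx A) (ctrmx B).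
Proof. by rewrite /ctrmx tr_col_mx map_row_mx. Qed.

Lemma ctrmx_block m1 m2 p1 p2 (A : 'M[R[i]]_(m1, p1)) (B : 'M_(m1, p2))
    (C : 'M_(m2, p1)) (D : 'M_(m2, p2)) :
  ctrmx (block_mx A B C D) = block_mx (ctrmx A) (ctrmx C) (ctrmx B) (ctrmx D).
Proof. by rewrite /ctrmx tr_block_mx map_block_mx. Qed.

Lemma smooth_block_mx (U : set M) m1 m2 p1 p2 (A : M -> 'M[R[i]]_(m1, p1))
    (B : M -> 'M_(m1, p2)) (C : M -> 'M_(m2, p1)) (D : M -> 'M_(m2, p2)) :
  open U -> smooth_mx U A -> smooth_mx U B -> smooth_mx U C -> smooth_mx U D ->
  smooth_mx U (fun x => block_mx (A x) (B x) (C x) (D x)).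
Proof.
move=> oU sA sB sC sD i j.
case: (splitP i) => i' Ei; case: (splitP j) => j' Ej.
- have [-> ->] : i = lshift m2 i' /\ j = lshift p2 j' by split; apply: val_inj.
  by apply: (smooth_fun_ext oU _ (sA i' j')) => x _; rewrite block_mxEul.
- have [-> ->] : i = lshift m2 i' /\ j = rshift p1 j' by split; apply: val_inj.
  by apply: (smooth_fun_ext oU _ (sB i' j')) => x _; rewrite block_mxEur.
- have [-> ->] : i = rshift m1 i' /\ j = lshift p2 j' by split; apply: val_inj.
  by apply: (smooth_fun_ext oU _ (sC i' j')) => x _; rewrite block_mxEdl.
- have [-> ->] : i = rshift m1 i' /\ j = rshift p1 j' by split; apply: val_inj.
  by apply: (smooth_fun_ext oU _ (sD i' j')) => x _; rewrite block_mxEdr.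
Qed.

Lemma smooth_mxD (U : set M) m p (A B : M -> 'M[R[i]]_(m, p)) : open U ->
  smooth_mx U A -> smooth_mx U B -> smooth_mx U (fun x => A x + B x).
Proof.
move=> oU sA sB i j.
apply: (smooth_fun_ext oU _ (smooth_funD oU (sA i j) (sB i j))).
by move=> x _; rewrite mxE.
Qed.

Lemma smooth_mxZ (U : set M) m p f (A : M -> 'M[R[i]]_(m, p)) : open U ->
  smooth_fun U f -> smooth_mx U A -> smooth_mx U (fun x => f x *: A x).
Proof.
move=> oU sf sA i j; apply: (smooth_fun_ext oU _ (smooth_funM oU sf (sA i j))).
by move=> x _; rewrite mxE.
Qed.

Lemma smooth_ctrmx (U : set M) m p (A : M -> 'M[R[i]]_(m, p)) : open U ->
  smooth_mx U A -> smooth_mx U (fun x => ctrmx (A x)).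
Proof.
move=> oU sA i j; apply: (smooth_fun_ext oU _ (smooth_fun_conj oU (sA j i))).
by move=> x _; rewrite !mxE.
Qed.

Definition posdef m (G : 'M[R[i]]_m) : Prop :=
  forall v : 'cV_m, v <> 0 -> 0 < (ctrmx v *m G *m v) ord0 ord0.

(* The Schur complement is the form of the block matrix on the vectors        *)
(* (p, w) with p = - a^-1 b w.                                                *)
Lemma posdef_schur m a (b : 'M[R[i]]_(1, m)) d : a^* = a -> a != 0 ->
  posdef (block_mx a%:M b (ctrmx b) d) -> posdef (d - a^-1 *: (ctrmx b *m b)).
Proof.
move=> aR a0 pG w w0; set p := - a^-1 *: (b *m w).
have := pG (col_mx p w); rewrite ctrmx_col mul_row_block mul_row_col.
rewrite (_ : _ + _ = ctrmx w *m (d - a^-1 *: (ctrmx b *m b)) *m w); last first.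
  have ap : a%:M *m p = - (b *m w).
    by rewrite mul_scalar_mx scalerA mulrN divff // scaleN1r.
  rewrite !mulmxDl -!mulmxA ap mulmxN addrACA addNr add0r addrC.
  rewrite mulmxBl mulmxBr -scalemxAl -mulmxA /p scaleNr !mulmxN.
  by rewrite -!scalemxAr.
apply=> /eqP; rewrite col_mx_eq0 => /andP[_ /eqP].
exact: w0.
Qed.

(** One step of elimination: the corner a is positive, and the Schur complement S is again
    Hermitian, positive definite and smooth in x. The factor of S is then bordered by sqrt a and b /
    sqrt a, which are smooth because a > 0. *)
Lemma smooth_cholesky (U : set M) m (G : M -> 'M[R[i]]_m) : open U ->
  smooth_mx U G -> (forall x, U x -> ctrmx (G x) = G x) ->
  (forall x, U x -> posdef (G x)) ->
  exists2 L : M -> 'M[R[i]]_m, smooth_mx U L &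
    forall x, U x -> G x = ctrmx (L x) *m L x.
Proof.
move=> oU; elim: m G => [|m IH] G sG hG pG.
  by exists G => // x _; rewrite [LHS]flatmx0 [RHS]flatmx0.
change ('I_m.+1) with ('I_(1 + m)) in *.
pose a x := G x ord0 ord0.
pose b x : 'M[R[i]]_(1, m) := @ursubmx _ 1 m 1 m (G x).
pose d x : 'M[R[i]]_m := @drsubmx _ 1 m 1 m (G x).
pose r x := Num.sqrt (complex.Re (a x)); pose s x := (r x)%:C%C.
have GE x : U x -> G x = block_mx (a x)%:M (b x) (ctrmx (b x)) (d x).
  move=> Ux; rewrite -[LHS](@submxK _ 1 m 1 m).
  apply: (f_equal4 (@block_mx R[i] 1 m 1 m)) => //.
    by rewrite [LHS]mx11_scalar /a !mxE !lshift0.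
  by rewrite /b /ctrmx trmx_ursub map_dlsubmx -/(ctrmx (G x)) hG.
have a0 x : U x -> 0 < a x.
  move=> Ux; have := pG x Ux (delta_mx ord0 ord0); rewrite ctrmx_delta.
  rewrite -rowE -colE !mxE; apply => /matrixP /(_ ord0 ord0) /eqP.
  by rewrite !mxE !eqxx oner_eq0.
have aE x : U x -> a x = (complex.Re (a x))%:C%C.
  by move=> /a0; case: (a x) => u v; rewrite ltcE /= => /andP[/eqP -> _].
have Ra0 x : U x -> 0 < complex.Re (a x).
  by move=> /a0; rewrite ltcE => /andP[].
have s0 x : U x -> 0 < s x by move=> /Ra0 ?; rewrite ltcR sqrtr_gt0.
have sn0 x : U x -> s x != 0 by move=> /s0 ?; rewrite gt_eqF.
have ss x : U x -> s x * s x = a x.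
  move=> Ux; rewrite /s -rmorphM /= -expr2 sqr_sqrtr ?(ltW (Ra0 x Ux)) //.
  by rewrite -aE.
have sR x : U x -> (s x)^* = s x.
  by move=> /s0 ?; rewrite conj_Creal // gtr0_real.
have aR x : U x -> (a x)^* = a x.
  by move=> /a0 ?; rewrite conj_Creal // gtr0_real.
have sa : smooth_fun U a by exact: sG.
have sb : smooth_mx U b.
  by move=> i j; apply: (smooth_fun_ext oU _ (sG (lshift m i) (rshift 1 j))) =>
    x _; rewrite !mxE.
have sd : smooth_mx U d.
  by move=> i j; apply: (smooth_fun_ext oU _ (sG (rshift 1 i) (rshift 1 j))) =>
    x _; rewrite !mxE.
have sai : smooth_fun U (fun x => (a x)^-1).
  by apply: smooth_funV => // x Ux; rewrite gt_eqF ?a0.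
have s_s : smooth_fun U s.
  have sRa : smooth_fun U (fun x => (complex.Re (a x))%:C%C).
    by apply: (smooth_fun_ext oU _ sa).
  exact: (smooth_fun_sqrt oU Ra0 sRa).
have ssi : smooth_fun U (fun x => (s x)^-1) by exact: smooth_funV.
pose S x := d x - (a x)^-1 *: (ctrmx (b x) *m b x).
have sS : smooth_mx U S.
  have smN : smooth_fun U (fun x => - (a x)^-1).
    apply: (smooth_fun_ext oU _ (smooth_funM oU (smooth_fun_cst U (- 1)) sai)).
    by move=> x _; rewrite mulN1r.
  have := smooth_mxD oU sd
    (smooth_mxZ oU smN (smooth_mxM oU (smooth_ctrmx oU sb) sb)).
  by move=> H i j; apply: (smooth_fun_ext oU _ (H i j)) => x _; rewrite scaleNr.
have hS x : U x -> ctrmx (S x) = S x.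
  move=> Ux; rewrite /S -scaleNr ctrmxD ctrmxZ ctrmxM ctrmxK rmorphN fmorphV /=.
  rewrite aR // scaleNr; congr (_ - _).
  by rewrite /d /ctrmx trmx_drsub map_drsubmx -/(ctrmx (G x)) hG.
have pS x : U x -> posdef (S x).
  move=> Ux; apply: posdef_schur; [exact: aR|by rewrite gt_eqF ?a0|].
  by rewrite -GE //; exact: pG.
have [L sL SL] := IH S sS hS pS.
have s_ul : smooth_mx U (fun x => (s x)%:M : 'M_1).
  move=> i j; apply: (smooth_fun_ext oU _ s_s) => x _.
  by rewrite !ord1 mxE eqxx.
have s_dl : smooth_mx U (fun=> 0 : 'M[R[i]]_(m, 1)).
  move=> i j; apply: (smooth_fun_ext oU _ (smooth_fun_cst U 0)) => x _.
  by rewrite mxE.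
(* The factor is upper triangular; the last block of its product with its adjoint is a^-1 b^* b + S
   = d. *)
exists (fun x => block_mx (s x)%:M ((s x)^-1 *: b x) 0 (L x)).
  exact: (smooth_block_mx oU s_ul (smooth_mxZ oU ssi sb) s_dl sL).
move=> x Ux; rewrite GE // (@ctrmx_block 1 m 1 m) ctrmxZ.
have -> : (s x)^-1^* = (s x)^-1 by rewrite fmorphV /= sR.
have -> : ctrmx (s x)%:M = (s x)%:M :> 'M_1.
  by rewrite /ctrmx tr_scalar_mx map_scalar_mx /= sR.
have -> : ctrmx (0 : 'M[R[i]]_(m, 1)) = 0.
  by apply/matrixP => i j; rewrite !mxE conjC0.
rewrite (@mulmx_block _ 1 m 1 m 1 m) !mul0mx !mulmx0 !addr0 -SL // /S.
apply: (f_equal4 (@block_mx R[i] 1 m 1 m)) => //.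
- by rewrite -scalar_mxM ss.
- by rewrite mul_scalar_mx scalerA divff ?scale1r ?sn0.
- by rewrite mul_mx_scalar scalerA divff ?scale1r ?sn0.
- by rewrite -scalemxAl -scalemxAr scalerA -invfM ss // addrC subrK.
Qed.

End Cholesky.

(** * Tight frames over compact sets *)

Section Frames.
Variables (R : realType) (n k : nat) (M : manifold R n) (E : complexBundle M k).

Lemma supp_notin (V : M -> lmodType R[i]) (s : forall x, V x) x :
  ~ supp s x -> s x = 0.
Proof. by move=> ns; apply: contrapT => sx; apply/ns/subset_closure. Qed.

(** Extension by zero: g f is smooth on V inter U as a product, and is 0 on V minus C; these two
    open sets cover V. *)
Lemma smooth_fun_mul_supp (V U C : set M) (f g : M -> R[i]) :
  open V -> open U -> closed C -> V `&` C `<=` U ->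
  (forall x, ~ C x -> f x = 0) ->
  smooth_fun U g -> smooth_fun V f -> smooth_fun V (fun x => g x * f x).
Proof.
move=> oV oU cC CU f0 sg sf.
have -> : V = (V `&` U) `|` (V `&` ~` C).
  rewrite -setIUr; apply/esym/setIidl => x Vx.
  by have [Cx|nCx] := pselect (C x); [left; exact: CU|right].
apply: smooth_funU.
  have oI := openI oV oU.
  apply: smooth_funM => //.
    by apply: smooth_fun_sub sg => x [].
  by apply: smooth_fun_sub sf => x [].
have oI := openI oV (closed_openC cC).
apply: (smooth_fun_ext oI _ (smooth_fun_cst _ 0)) => x [_ nC].
by rewrite f0 // mulr0.
Qed.

(** * Multiplication by a function that is smooth only near the support *)

Section Scale.
Variables (U : set M) (g : M -> R[i]).
Hypotheses (oU : open U) (sg : smooth_fun U g).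

Lemma ccfun_scale (f : ccfun M) : supp f `<=` U ->
  exists f' : ccfun M, forall x, f' x = g x * f x.
Proof.
move=> fU; have [sf cf] := pi_funP f.
suff P : ccfun_pred (fun x => g x * f x).
  by exists (PiSub (@ccfun_closed _ _ M) P).
split; last by apply: (supp_compactS _ cf) => x ->; rewrite mulr0.
apply: (smooth_fun_mul_supp openT oU (@closed_closure _ _)) => // [x [_]|].
  exact: fU.
by move=> x /supp_notin.
Qed.

Lemma ccsection_scale (u : ccsection E) : supp u `<=` U ->
  exists u' : ccsection E, forall x, u' x = g x *: u x.
Proof.
move=> uU; have [su cu] := pi_funP u.
suff P : ccsection_pred (fun x => g x *: u x).
  by exists (PiSub (@ccsection_closed _ _ M _ E) P).
split; last by apply: (supp_compactS _ cu) => x ->; rewrite scaler0.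
move=> t tt j; have oT := tdom_open t.
(* [tmap t] is meaningless off [tdom t], so the coordinate is set to 0 there; it then vanishes at
   every point outside the support. *)
pose c x : R[i] := if `[< tdom t x >] then tmap t (u x) j ord0 else 0.
have cE x : tdom t x -> c x = tmap t (u x) j ord0 by rewrite /c; case: asboolP.
have sc : smooth_fun (tdom t) c.
  by apply: (smooth_fun_ext oT _ (su t tt j)) => x tx; rewrite cE.
have := smooth_fun_mul_supp oT oU (@closed_closure _ [set x | u x <> 0])
  _ _ sg sc.
move=> /(_ _ _) H; apply: (smooth_fun_ext oT _ (H _ _)) => [x tx|x [_]|x nx].
- by rewrite cE // tmapZ // mxE.
- exact: uU.
- rewrite /c; case: asboolP => // tx; rewrite (supp_notin nx) tmap0 //.
  by rewrite mxE.
Qed.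

Lemma ccendo_scale (A : ccendo E) :
  supp (V := fun x => ((E x -> E x) : lmodType R[i])) A `<=` U ->
  exists A' : ccendo E, forall x v, A' x v = g x *: A x v.
Proof.
move=> AU; have [lA sA cA] := pi_funP A.
suff P : ccendo_pred (E := E) (fun x v => g x *: A x v).
  by exists (PiSub (@ccendo_closed _ _ M _ E) P).
split.
- by move=> x a v w; rewrite lA scalerDr !scalerA mulrC.
- move=> t tt v j; have oT := tdom_open t.
  pose c x : R[i] :=
    if `[< tdom t x >] then tmap t (A x (tinv t x v)) j ord0 else 0.
  have cE x : tdom t x -> c x = tmap t (A x (tinv t x v)) j ord0.
    by rewrite /c; case: asboolP.
  have sc : smooth_fun (tdom t) c.
    by apply: (smooth_fun_ext oT _ (sA t tt v j)) => x tx; rewrite cE.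
  have := smooth_fun_mul_supp oT oU (@closed_closure _
    [set x | (A x : ((E x -> E x) : lmodType R[i])) <> 0]) _ _ sg sc.
  move=> /(_ _ _) H; apply: (smooth_fun_ext oT _ (H _ _)) => [x tx|x [_]|x nx].
  + by rewrite cE // tmapZ // mxE.
  + exact: AU.
  + rewrite /c; case: asboolP => // tx.
    have -> : A x = 0.
      exact: (supp_notin (V := fun x => ((E x -> E x) : lmodType R[i])) nx).
    by rewrite tmap0 // mxE.
- by apply: (supp_compactS _ cA) => x A0; apply/funext => v; rewrite A0 scaler0.
Qed.

End Scale.

Lemma ccsection_cutoff t (s : forall x, E x) (chi : M -> R[i]) (K : set M) :
  trivs E t ->
  (forall j, smooth_fun (tdom t) (fun x => tmap t (s x) j ord0)) ->
  smooth_fun setT chi -> compact K -> K `<=` tdom t ->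
  (forall x, chi x != 0 -> K x) -> ccsection_pred (fun x => chi x *: s x).
Proof.
move=> tt ss sc cK Kt chiK.
have clK : closed K by apply: compact_closed cK; exact: mf_hausdorff.
have chi0 x : ~ K x -> chi x = 0.
  by move=> nK; apply: contrapT => /eqP/chiK.
split; last first.
  apply: (subclosed_compact _ cK); first exact: closed_closure.
  rewrite [X in _ `<=` X]((closure_id K).1 clK); apply: closureS => x /= cs.
  by apply: contrapT => /chi0 c0; apply: cs; rewrite c0 scale0r.
move=> t' tt' j; have [oT oT'] := (tdom_open t, tdom_open t').
have oI := openI oT oT'.
have sI : smooth_fun (tdom t `&` tdom t') (fun x => tmap t' (s x) j ord0).
  (* To pass to another trivialization t', s is expanded in the frame of t, whose t'-coordinates are
     smooth on the overlap by [trivs_compat]. *)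
  have H i : smooth_fun (tdom t `&` tdom t') (fun x =>
      tmap t (s x) i ord0 * tmap t' (tframe t x i) j ord0).
    apply: smooth_funM => //; last exact: trivs_compat.
    by apply: smooth_fun_sub (ss i) => x [].
  apply: (smooth_fun_ext oI _ (smooth_fun_sum oI (index_enum _) xpredT H)).
  move=> x [tx t'x]; rewrite [in RHS](tframeE tx (s x)).
  rewrite (big_morph _ (tmapD t'x) (tmap0 t'x)) summxE.
  by apply: eq_bigr => i _; rewrite tmapZ // mxE.
have sc' : smooth_fun (tdom t') chi by apply: smooth_fun_sub sc.
have := smooth_fun_mul_supp oT' oI clK _ chi0 sI sc'.
move=> H; apply: (smooth_fun_ext oT' _ (H _)) => [x t'x|x [t'x Kx]].
  by rewrite tmapZ // mxE mulrC.
by split=> //; exact: Kt.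
Qed.

Variable h : hermitianMetric E.

Lemma hm_sumr x (I : Type) (r : seq I) (u : E x) (F : I -> E x) :
  h x u (\sum_(i <- r) F i) = \sum_(i <- r) h x u (F i).
Proof. exact: (big_morph _ (hmDr h u) (hm0r h u)). Qed.

(** If L^* L is the Gram matrix, the columns of L^-1 are the coordinates of an orthonormal frame:
    h(e_i, v) is the i-th entry of L v, and the expansion of v reads L^-1 L v = v. *)
Lemma orthonormal_frame t : trivs E t ->
  exists e : 'I_k -> forall x, E x,
  [/\ forall i j, smooth_fun (tdom t) (fun x => tmap t (e i x) j ord0),
      forall x, tdom t x -> forall i, h x (e i x) (e i x) = 1
    & forall x, tdom t x -> forall v : E x, \sum_i h x (e i x) v *: e i x = v].
Proof.
move=> tt; have oT := tdom_open t.
have [|L sL GL] := smooth_cholesky oT (smooth_gram h tt)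
  (fun x _ => gram_herm h t x).
  move=> x tx v v0; rewrite -(tinvK tx v) -gramE //; apply: hm_pos => tv0.
  by apply: v0; rewrite -(tinvK tx v) tv0 tmap0.
have uL x : tdom t x -> L x \in unitmx.
  by move=> tx; have := gram_unit h tx; rewrite GL // unitmx_mul => /andP[].
have sV := smooth_mxV oT uL sL.
pose e i x : E x := tinv t x (col i (invmx (L x))).
have Lc x i : tdom t x -> L x *m col i (invmx (L x)) = delta_mx i ord0.
  by move=> tx; rewrite colE mulmxA mulmxV ?uL // mul1mx.
have he x i (v : E x) : tdom t x -> h x (e i x) v = (L x *m tmap t v) i ord0.
  move=> tx; rewrite (gramE _ _ _ tx) GL // tinvK // mulmxA -ctrmxM -mulmxA.
  rewrite Lc //.
  by rewrite ctrmx_delta -rowE mxE.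
exists e; split.
- move=> i j; apply: (smooth_fun_ext oT _ (sV j i)) => x tx.
  by rewrite tinvK // mxE.
- move=> x tx i; rewrite he // tinvK // Lc //.
  by rewrite mxE !eqxx.
- move=> x tx v; rewrite -[RHS](tmapK tx) -[LHS](tmapK tx); congr tinv.
  rewrite (big_morph _ (tmapD tx) (tmap0 tx)).
  rewrite -[RHS](mulKmx (uL x tx)); apply/colP => j; rewrite summxE mxE.
  by apply: eq_bigr => i _; rewrite tmapZ // he // tinvK // !mxE mulrC.
Qed.

(* [phi] is a sum of squared bump functions and [ws] collects the orthonormal *)
(* frames cut off by them, hence the identity holds on all of M.              *)
Lemma tight_frame (K : set M) : compact K ->
  exists (ws : seq (ccsection E)) (phi : M -> R),
  [/\ smooth_fun setT (fun x => (phi x)%:C%C),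
      forall x, 0 <= phi x, forall x, K x -> 0 < phi x,
      forall x, \sum_(w <- ws) h x (w x) (w x) = k%:R * (phi x)%:C%C
    & forall x v, \sum_(w <- ws) h x (w x) v *: w x = (phi x)%:C%C *: v].
Proof.
move=> cK; pattern K; apply: (compact_ind cK).
- exists [::], (fun=> 0); split=> // [|x|x v]; first exact: smooth_fun_cst.
    by rewrite big_nil mulr0.
  by rewrite big_nil scale0r.
- move=> A B AB [ws [phi [s p0 pB tr id]]]; exists ws, phi; split=> // x /AB.
  exact: pB.
(* All the identities are additive: concatenating the families adds the factors phi, and
   nonnegativity keeps the sum positive on both sets. *)
- move=> A B [ws [phi [s p0 pA tr id]]] [ws' [phi' [s' p0' pB tr' id']]].
  exists (ws ++ ws'), (fun x => phi x + phi' x); split.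
  + apply: (smooth_fun_ext openT _ (smooth_funD openT s s')) => x _.
    by rewrite rmorphD.
  + by move=> x; rewrite addr_ge0.
  + by move=> x [/pA|/pB] px; [rewrite ltr_pwDl|rewrite ltr_pwDr].
  + by move=> x; rewrite big_cat /= tr tr' rmorphD mulrDr.
  + by move=> x v; rewrite big_cat /= id id' rmorphD scalerDl.
move=> x _; have [t tt tx] := trivs_cover E x.
have [chi [sc cx [K' [cK' K't chiK]]]] := bump_function (tdom_open t) tx.
have [e [se e1 eE]] := orthonormal_frame tt.
have cC y : (chi y)%:C%C != 0 -> K' y.
  by move=> cy; apply: chiK; apply: contra_neq cy => ->.
pose w i : ccsection E := PiSub (@ccsection_closed _ _ M _ E)
  (ccsection_cutoff tt (se i) sc cK' K't cC).
have cxC : (chi x)%:C%C != 0 :> R[i] by rewrite (fmorph_eq0 (real_complex R)).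
exists [set y | (chi y)%:C%C != 0 :> R[i]]; first exact: smooth_fun_neq0.
have cJ y : ((chi y)%:C%C : R[i])^* = (chi y)%:C%C.
  by rewrite conj_Creal // complex_real.
have c0 y : ~ tdom t y -> chi y = 0.
  by move=> nt; apply: contrapT => /eqP/chiK/K't.
exists [seq w i | i : 'I_k], (fun y => chi y ^+ 2); split.
- apply: (smooth_fun_ext openT _ (smooth_funM openT sc sc)) => y _.
  by rewrite expr2 rmorphM.
- by move=> y; rewrite sqr_ge0.
- move=> y /= cy; rewrite lt_neqAle sqr_ge0 andbT eq_sym sqrf_eq0.
  by apply: contra_neq cy => ->.
- move=> y; rewrite big_map big_enum /=.
  have [ty|/c0 cy] := pselect (tdom t y); last first.
    rewrite cy big1 => [|i _]; first by rewrite expr0n mulr0.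
    by rewrite scale0r hm0r.
  rewrite (eq_bigr (fun=> (chi y ^+ 2)%:C%C)) => [|i _].
    by rewrite sumr_const card_ord mulr_natl.
  by rewrite hmZl hmZr e1 // mulr1 cJ expr2 rmorphM.
- move=> y v; rewrite big_map big_enum /=.
  have [ty|/c0 cy] := pselect (tdom t y); last first.
    rewrite cy big1 => [|i _]; first by rewrite expr0n scale0r.
    by rewrite scale0r scaler0.
  rewrite -[in RHS](eE y ty v) scaler_sumr; apply: eq_bigr => i _.
  by rewrite hmZl cJ !scalerA expr2 rmorphM mulrAC.
Qed.

End Frames.

(** * Sums of squares and positivity *)

Section SumOfSquares.
Variable C : numClosedFieldType.

(* The decomposition may depend on s: if M is not compact, no finite family   *)
(* of compactly supported sections serves all sections at once.               *)
Definition sum_of_squares (D : starAlgebra C) (T : eqType) (g : T -> T -> D) :=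
  forall s : seq T, exists (I : Type) (r : seq I) (a : I -> T -> D),
    {in s &, forall x y, g x y = \sum_(i <- r) smul (star (a i x)) (a i y)}.

Lemma sum_of_squares_cone (D : starAlgebra C) (T : eqType) (g : T -> T -> D) x :
  sum_of_squares g -> positive_cone (g x x).
Proof.
move=> /(_ [:: x])[I [r [a ->]]]; rewrite ?mem_head //; split.
  have s0 : star (0 : D) = 0.
    by rewrite -[X in star X](scale0r 0) starZ conjC0 scale0r.
  rewrite (big_morph _ (@starD _ D) s0); apply: eq_bigr => i _.
  by rewrite starM starK.
by move=> omega pos; rewrite linear_sum; apply: sumr_ge0 => i _; apply: pos.
Qed.

(** On z = sum_p x_p (x) psi_p the form equals sum_i |sum_p pi(a_i x_p) psi_p|^2. The decomposition
    is taken for the finitely many x_p in a representative of z. *)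
Lemma sum_of_squares_property_P (B A : starAlgebra C) (X : bimodule B A)
  (g : X -> X -> A) : sum_of_squares g -> property_P g.
Proof.
move=> sq H pi z; rewrite /tensor_form; set s := repr z.
have [I [r [a gE]]] := sq [seq p.1 | p <- s].
have repE p q : p \in s -> q \in s -> ip p.2 (pi (g p.1 q.1) q.2) =
    \sum_(i <- r) ip (pi (a i p.1) p.2) (pi (a i q.1) q.2).
  move=> ps qs; rewrite gE; [|exact: map_f|exact: map_f].
  elim: r {gE} => [|i r IH].
    have pi0 : pi 0 = 0.
      have := rep_linear pi (- 1) 0 0; rewrite !scaleN1r oppr0 addr0 => ->.
      by rewrite addNr.
    by rewrite !big_nil pi0 ip0r.
  rewrite !big_cons -IH -[smul _ _ + _](congr1 (fun x => x + _) (scale1r _)).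
  by rewrite rep_linear scale1r piSubDE ipDr repM rep_star /= ip_starE.
have ipsumr x (t : seq (X * H)) (f : X * H -> H) :
    ip x (\sum_(q <- t) f q) = \sum_(q <- t) ip x (f q).
  exact: (big_morph _ (ipDr x) (ip0r x)).
have ipsuml y (t : seq (X * H)) (f : X * H -> H) :
    ip (\sum_(q <- t) f q) y = \sum_(q <- t) ip (f q) y.
  rewrite ip_herm ipsumr rmorph_sum; apply: eq_bigr => q _ /=.
  by rewrite -ip_herm.
have ip_ge0 (x : H) : 0 <= ip x x.
  have [->|/ip_pos/ltW//] := pselect (x = 0); by rewrite ip0r.
have -> : \sum_(p <- s) \sum_(q <- s) ip p.2 (pi (g p.1 q.1) q.2) =
    \sum_(i <- r) ip (\sum_(p <- s) pi (a i p.1) p.2)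
                     (\sum_(p <- s) pi (a i p.1) p.2).
  transitivity (\sum_(i <- r) \sum_(p <- s) \sum_(q <- s)
      ip (pi (a i p.1) p.2) (pi (a i q.1) q.2)).
    rewrite [RHS]exchange_big; apply: eq_big_seq => p ps.
    rewrite [RHS]exchange_big; apply: eq_big_seq => q qs.
    exact: repE.
  apply: eq_bigr => i _; rewrite ipsuml.
  by apply: eq_bigr => p _; rewrite ipsumr.
by apply: sumr_ge0 => i _; apply: ip_ge0.
Qed.

End SumOfSquares.

(** * Sums of squares and fullness for the two inner products *)

Section Sections.
Variables (R : realType) (n k : nat) (M : manifold R n) (E : complexBundle M k).
Variable h : hermitianMetric E.

(** The open set where phi does not vanish contains K; a quotient by phi must be smooth on a
    neighbourhood of a support, not just on it. *)
Lemma tight_frame_nbhd (K : set M) : compact K ->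
  exists (ws : seq (ccsection E)) (phi : M -> R) (U : set M),
  [/\ [/\ open U, K `<=` U, forall x, U x -> 0 < phi x & forall x, 0 <= phi x],
      smooth_fun U (fun x => (phi x)%:C%C),
      forall x, \sum_(w <- ws) h x (w x) (w x) = k%:R * (phi x)%:C%C
    & forall x v, \sum_(w <- ws) h x (w x) v *: w x = (phi x)%:C%C *: v].
Proof.
move=> cK; have [ws [phi [sphi phi0 phiK tr id]]] := tight_frame h cK.
exists ws, phi, [set x | (phi x)%:C%C != 0 :> R[i]]; split=> //; last first.
  exact: smooth_fun_sub sphi.
split=> // [|x /phiK px|x /= px].
- by rewrite openE => x Ux; exact: smooth_fun_neq0 sphi Ux.
- by rewrite /= (fmorph_eq0 (real_complex R)) gt_eqF.
- rewrite lt_neqAle phi0 andbT eq_sym.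
  by apply: contra_neq px => ->.
Qed.

(** F u is u / sqrt(c phi) for the listed sections, with K the union of their supports. The constant
    c is 1 for the metric and k for Theta, to match the factors phi and k phi in the two frame
    identities. *)
Lemma normalized_sections (us : seq (ccsection E)) (c : R) : 0 < c ->
  exists (ws : seq (ccsection E)) (phi : M -> R)
    (F : ccsection E -> ccsection E),
  [/\ forall x, 0 <= phi x,
      forall x, \sum_(w <- ws) h x (w x) (w x) = k%:R * (phi x)%:C%C,
      forall x v, \sum_(w <- ws) h x (w x) v *: w x = (phi x)%:C%C *: v
    & {in us, forall u x, (Num.sqrt (c * phi x))%:C%C *: F u x = u x}].
Proof.
move=> c0; pose K := \big[setU/set0]_(u <- us) supp u.
have cK : compact K by apply: bigsetU_compact => u _; have [] := pi_funP u.
have [ws [phi [U [[oU KU Uphi phi0] sphi tr id]]]] := tight_frame_nbhd cK.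
have Ucphi x : U x -> 0 < c * phi x by move=> /Uphi; exact: mulr_gt0.
have sc : smooth_fun U (fun x => (c * phi x)%:C%C).
  have := smooth_funM oU (smooth_fun_cst U c%:C%C) sphi.
  by apply: (smooth_fun_ext oU) => x _; rewrite rmorphM.
have sn0 x : U x -> (Num.sqrt (c * phi x))%:C%C != 0 :> R[i].
  move=> /Ucphi ?; rewrite (fmorph_eq0 (real_complex R)) sqrtr_eq0 -ltNge //.
have sg := smooth_funV oU sn0 (smooth_fun_sqrt oU Ucphi sc).
have /choice[F FE] : forall u, exists u' : ccsection E, u \in us ->
    forall x, u' x = ((Num.sqrt (c * phi x))%:C%C)^-1 *: u x.
  move=> u; have [uus|] := boolP (u \in us); last by exists u.
  have [|u' u'E] := ccsection_scale oU sg (u := u).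
    apply: subset_trans KU; by rewrite /K -bigcup_seq => x ux; exists u.
  by exists u'.
exists ws, phi, F; split=> // u uus x; rewrite FE //.
have [Ux|nUx] := pselect (U x); first by rewrite scalerA divff ?scale1r ?sn0.
rewrite (_ : u x = 0) ?scaler0 //; apply: supp_notin => ux; apply/nUx/KU.
by rewrite /K -bigcup_seq; exists u.
Qed.

Lemma ccfun_sumE (I : Type) (r : seq I) (f : I -> ccfun_algebra M) x :
  (\sum_(i <- r) f i : ccfun M) x = \sum_(i <- r) (f i : ccfun M) x.
Proof. exact: (big_morph (fun f : ccfun M => f x)). Qed.

Lemma ccendo_sumE (I : Type) (r : seq I) (A : I -> ccendo_algebra h) x v :
  (\sum_(i <- r) A i : ccendo E) x v = \sum_(i <- r) (A i : ccendo E) x v.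
Proof. exact: (big_morph (fun A : ccendo E => A x v)). Qed.

Lemma conj_sqrtC (r : R) : ((Num.sqrt r)%:C%C : R[i])^* = (Num.sqrt r)%:C%C.
Proof. by rewrite conj_Creal // complex_real. Qed.

Lemma sqrtC_sqr (r : R) : 0 <= r ->
  (Num.sqrt r)%:C%C * (Num.sqrt r)%:C%C = r%:C%C :> R[i].
Proof. by move=> r0; rewrite -rmorphM /= -expr2 sqr_sqrtr. Qed.

(** With u' = F u and v' = F v, h(u,v) = h(u', phi v'); expanding phi v' in the frame gives the
    terms h(u',w) h(w,v'). *)
Lemma sum_of_squares_metric :
  @sum_of_squares _ (ccfun_algebra M) (ccsection E) (section_metric h).
Proof.
move=> us; have [ws [phi [F [phi0 _ id FE]]]] := normalized_sections us ltr01.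
exists (ccsection E), ws, (fun w u => section_metric h w (F u)) => u v uus vus.
apply: piSub_ext => x; rewrite ccfun_sumE.
rewrite -[LHS]/(h x (u x) (v x)) -(FE u uus x) -(FE v vus x) mul1r.
rewrite hmZl hmZr mulrA conj_sqrtC sqrtC_sqr // -hmZr -id hm_sumr.
apply: eq_bigr => w _.
rewrite -[RHS]/((h x (w x) (F u x))^* * h x (w x) (F v x)) hmZr mulrC.
by rewrite -hm_herm.
Qed.

(** The adjoint of Theta_{u,v} is Theta_{v,u}. *)
Lemma theta_starE (u v : ccsection E) x (w : E x) :
  (star (section_theta h u v : ccendo_algebra h) : ccendo E) x w =
  h x (u x) w *: v x.
Proof.
apply: (@ip_inj _ (fiber_hilbert h x)) => z.
rewrite [LHS](hm_starr h (section_theta h u v) z w).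
by rewrite [LHS]hmZl [RHS]hmZr mulrC -hm_herm.
Qed.

Lemma sum_of_squares_theta : (0 < k)%N ->
  @sum_of_squares _ (ccendo_algebra h) (ccsection E) (section_theta h).
Proof.
move=> k0 us; have kR : 0 < k%:R :> R by rewrite ltr0n.
have [ws [phi [F [phi0 tr _ FE]]]] := normalized_sections us kR.
exists (ccsection E), ws, (fun w u => section_theta h w (F u)) => u v uus vus.
apply: piSub_ext => x; apply/funext => z; rewrite ccendo_sumE.
rewrite -[LHS]/(h x (v x) z *: u x) -(FE u uus x) -(FE v vus x).
rewrite hmZl conj_sqrtC scalerA mulrAC sqrtC_sqr ?mulr_ge0 ?ler0n //.
(* The factor k phi becomes the sum of the h(w,w), since Theta_{w,u'}^* Theta_{w,v'} sends z to
   h(w,w) h(v',z) u'. *)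
rewrite rmorphM rmorph_nat -tr !mulr_suml scaler_suml.
apply: eq_bigr => w _; rewrite [RHS](theta_starE w (F u)).
by rewrite -[X in _ = _ *: X]/(F u x) [in RHS]hmZr mulrC.
Qed.

Lemma full_metric : (0 < k)%N ->
  @full _ _ _ (section_bimodule h) (ccfun_algebra M) (section_metric h).
Proof.
move=> k0 f; have [_ cf] := pi_funP (f : ccfun M).
have [ws [phi [U [[oU fU Uphi _] sphi tr _]]]] := tight_frame_nbhd cf.
have kphi0 x : U x -> k%:R * (phi x)%:C%C != 0 :> R[i].
  move=> /Uphi px; rewrite mulf_neq0 ?pnatr_eq0 -?lt0n //.
  by rewrite (fmorph_eq0 (real_complex R)) gt_eqF.
have sg := smooth_funV oU kphi0 (smooth_funM oU (smooth_fun_cst U k%:R) sphi).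
have [f' f'E] := ccfun_scale oU sg fU.
exists [seq (1, (w, fun_act w f')) | w : ccsection E <- ws].
rewrite big_map; apply: piSub_ext => x; rewrite ccfun_sumE.
transitivity (\sum_(w <- ws) h x (w x) (w x) * f' x); last first.
  by apply: eq_bigr => w _; rewrite scale1r [RHS]hmZr mulrC.
rewrite -mulr_suml tr f'E.
have [Ux|nUx] := pselect (U x); first by rewrite mulVKf ?kphi0.
by rewrite [f x](supp_notin (fun fx => nUx (fU x fx))) !mulr0.
Qed.

Lemma full_theta :
  @full _ _ _ (section_bimodule h) (ccendo_algebra h) (section_theta h).
Proof.
move=> A; have [_ _ cA] := pi_funP (A : ccendo E).
have [ws [phi [U [[oU AU Uphi _] sphi _ id]]]] := tight_frame_nbhd cA.
have phi0 x : U x -> (phi x)%:C%C != 0 :> R[i].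
  by move=> /Uphi px; rewrite (fmorph_eq0 (real_complex R)) gt_eqF.
have [A' A'E] := ccendo_scale oU (smooth_funV oU phi0 sphi) AU.
exists [seq (1, (endo_act A' w, w)) | w : ccsection E <- ws].
rewrite big_map; apply: piSub_ext => x; apply/funext => v; rewrite ccendo_sumE.
transitivity (\sum_(w <- ws) h x (w x) v *: A' x (w x)); last first.
  by apply: eq_bigr => w _; rewrite scale1r.
(* A' = A / phi is pulled out of the sum by linearity, leaving the resolution of the identity
   applied to v. *)
transitivity (A' x (\sum_(w <- ws) h x (w x) v *: w x)); last first.
  rewrite (big_morph _ (ccendoD A' (x := x)) (ccendo0 A' x)).
  by apply: eq_bigr => w _; rewrite ccendoZ.
rewrite id ccendoZ A'E.
have [Ux|nUx] := pselect (U x); first by rewrite scalerA divff ?scale1r ?phi0.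
have -> : (A : ccendo E) x = 0.
  exact: (supp_notin (V := fun x => ((E x -> E x) : lmodType R[i]))
    (fun Ax => nUx (AU x Ax))).
by rewrite !scaler0.
Qed.

End Sections.

(** * The equivalence bimodule axioms *)

Theorem proposition6p8 (R : realType) (n k : nat) (hk : (0 < k)%N)
    (M : manifold R n) (E : complexBundle M k) (h : hermitianMetric E) :
  @equivalence_bimodule _ (ccendo_algebra h) (ccfun_algebra M)
    (section_bimodule h) (section_metric h) (section_theta h).
Proof.
have sqA := sum_of_squares_metric h; have sqB := sum_of_squares_theta h hk.
split.
- split=> [u a v w|u v f|u v]; apply: piSub_ext => x.
  + exact: hm_linear.
  + by rewrite [LHS]hmZr mulrC.
  + exact: hm_herm.
- split=> [v a u w|A u v|u v]; apply: piSub_ext => x; apply/funext => z.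
  + rewrite -[RHS]/(a *: (h x (v x) z *: u x) + h x (v x) z *: w x).
    by rewrite [LHS]scalerDr !scalerA mulrC.
  + by rewrite [RHS]ccendoZ.
  + by rewrite [RHS]theta_starE.
- by move=> u; exact: sum_of_squares_cone sqA.
- by move=> u; exact: sum_of_squares_cone sqB.
- exact: full_metric.
- exact: full_theta.
- move=> A u v; apply: piSub_ext => x.
  by rewrite [RHS](hm_starr h (A : ccendo E)).
- move=> u f v; apply: piSub_ext => x; apply/funext => z.
  rewrite -[LHS]/(h x (v x) z *: ((f : ccfun M) x *: u x)) scalerA mulrC.
  by rewrite -[RHS]/(h x (((f : ccfun M) x)^* *: v x) z *: u x) hmZl conjCK.
- by move=> u v w; apply: piSub_ext => x.
- exact: (sum_of_squares_property_P (X := section_bimodule h) sqA).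
(* The conjugate module has the same elements and the same Theta, and being a sum of squares does
   not refer to the module structure. *)
- exact: (sum_of_squares_property_P (X := conj_bimodule (section_bimodule h))
    sqB).
Qed.
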